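(* Let $n,m\ge1$ be integers, $p\in(0,1)$, and let $\pi\sim\nu^{(p)}_{n,m}$. If $Q$ is a standard Young tableau of shape $\lambda\vdash n$, then $$\mathbb{P}\{Q(\pi^{-1})=Q\}=S_\lambda^{(m,p)}.$$ Consequently, $$\mathbb{P}\{\operatorname{sh}(\pi)=\lambda\}=f^\lambda S_\lambda^{(m,p)},$$ where $f^\lambda$ is the number of standard Young tableaux of shape $\lambda$.
   Context: Asymmetric shelf shuffle: let $m\ge 1$ be an integer, $p\in(0,1)$, $q=1-p$. A deck of $n$ cards labelled $1,\ldots,n$ from top to bottom is dealt sequentially from the bottom (card $n$ first, card $1$ last). Each card is assigned to one of $m$ labelled shelves independently and uniformly at random, and is placed at the top of the existing pile on that shelf with probability $p$ and at the bottom with probability $q$, independently of everything else. The shuffled deck is formed by joining the piles in shelf order (shelf $1$ on top, then shelf $2$, and so on). The resulting random permutation is $\pi=(\pi_1,\ldots,\pi_n)\in S_n$, where $\pi_i$ is the label of the card in position $i$ from the top, and $\nu^{(p)}_{n,m}$ denotes its law on $S_n$. For $\sigma\in S_n$, $\operatorname{RSK}(\sigma)=(P(\sigma),Q(\sigma))$ is the pair of standard Young tableaux given by the Robinson–Schensted–Knuth correspondence (row insertion of $\sigma_1,\sigma_2,\ldots,\sigma_n$): $P(\sigma)$ is the insertion tableau, $Q(\sigma)$ the recording tableau, and $\operatorname{sh}(\sigma)$ their common shape. Let $\mathcal{A}_m=\{1^+,1^-,2^+,2^-,\ldots,m^+,m^-\}$, totally ordered by $1^+<1^-<2^+<2^-<\cdots<m^+<m^-$,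 with weights $\operatorname{wt}(j^+)=p/m$ and $\operatorname{wt}(j^-)=q/m$. For a partition $\lambda$, $\operatorname{SSYT}^{\pm}_m(\lambda)$ is the set of fillings $T$ of the Young diagram of $\lambda$ with letters of $\mathcal{A}_m$ such that entries are weakly increasing along rows and down columns, each letter $j^+$ appears at most once in each column, and each letter $j^-$ appears at most once in each row. Define $$S_\lambda^{(m,p)}:=\sum_{T\in\operatorname{SSYT}^{\pm}_m(\lambda)}\ \prod_{b\in\lambda}\operatorname{wt}(T(b)),$$ where the product is over boxes $b$ of $\lambda$ and $T(b)$ is the entry of $T$ in $b$. *)

(* Defs.v *)
From mathcomp Require Import all_boot all_order all_algebra all_fingroup.

Set Implicit Arguments.
Unset Strict Implicit.
Unset Printing Implicit Defensive.

Import GRing.Theory.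

(* Cards, deck positions and shelves are numbered from 0, as are the entries  *)
(* of standard tableaux: k : 'I_n stands for the label k + 1.                 *)

(** * Partitions and fillings *)

Definition is_partition (n : nat) (la : seq nat) : bool :=
  [&& sorted geq la, all (ltn 0) la & sumn la == n].

Definition box (la : seq nat) : Type := {i : 'I_(size la) & 'I_(nth 0 la i)}.

Definition row_of (la : seq nat) (b : box la) : nat := tag b.
Definition col_of (la : seq nat) (b : box la) : nat := tagged b.

Definition is_standard (n : nat) (la : seq nat)
    (T : {ffun box la -> 'I_n}) : bool :=
  [&& [forall k : 'I_n, #|[set b | T b == k]| == 1],
      [forall b, forall c,
         (row_of b == row_of c) && (col_of b < col_of c) ==> (T b < T c)]
    & [forall b, forall c,
         (col_of b == col_of c) && (row_of b < row_of c) ==> (T b < T c)]].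

Definition num_standard (n : nat) (la : seq nat) : nat :=
  #|[set T : {ffun box la -> 'I_n} | is_standard T]|.

(** * Robinson-Schensted-Knuth correspondence *)

(* Tableaux built by insertion are lists of rows, top row first. *)

(* The second component is the bumped entry, if any. *)
Fixpoint row_insert (x : nat) (r : seq nat) : seq nat * option nat :=
  if r is y :: r' then
    if (x < y) then (x :: r', Some y)
    else let: (r'', bumped) := row_insert x r' in (y :: r'', bumped)
  else ([:: x], None).

(* The second component is the index of the row that gained a box. *)
Fixpoint tab_insert (x : nat) (t : seq (seq nat)) : seq (seq nat) * nat :=
  if t is r :: t' then
    match row_insert x r with
    | (r', None) => (r' :: t', 0)
    | (r', Some y) => let: (t'', i) := tab_insert y t' in (r' :: t'', i.+1)
    end
  else ([:: [:: x]], 0).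

Definition rsk_step (PQ : seq (seq nat) * seq (seq nat)) (kx : nat * nat) :
    seq (seq nat) * seq (seq nat) :=
  let: (P, i) := tab_insert kx.2 PQ.1 in
  (P, set_nth [::] PQ.2 i (rcons (nth [::] PQ.2 i) kx.1)).

Definition rsk_word (w : seq nat) : seq (seq nat) * seq (seq nat) :=
  foldl rsk_step ([::], [::]) (zip (iota 0 (size w)) w).

Definition rsk (n : nat) (s : 'S_n) : seq (seq nat) * seq (seq nat) :=
  rsk_word [seq val (s i) | i <- enum 'I_n].

Definition P_tab (n : nat) (s : 'S_n) : seq (seq nat) := (rsk s).1.
Definition Q_tab (n : nat) (s : 'S_n) : seq (seq nat) := (rsk s).2.
Definition rsk_shape (n : nat) (s : 'S_n) : seq nat := map size (P_tab s).

(* The list of rows t and the filling T are the same tableau. *)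
Definition same_tab (n : nat) (la : seq nat) (t : seq (seq nat))
    (T : {ffun box la -> 'I_n}) : bool :=
  (map size t == la) &&
  [forall b, nth 0 (nth [::] t (row_of b)) (col_of b) == T b :> nat].

(** * Asymmetric shelf shuffle *)

(* w c = (j, e): card c goes to shelf j, on top of the pile if e = true and   *)
(* at its bottom if e = false. The head of a list is its top card.            *)
Definition deal (n m : nat) (w : {ffun 'I_n -> 'I_m * bool}) (c : 'I_n)
    (piles : 'I_m -> seq 'I_n) : 'I_m -> seq 'I_n :=
  fun j => if j == (w c).1
           then if (w c).2 then c :: piles j else rcons (piles j) c
           else piles j.

(* foldr deals the last card of enum 'I_n first. *)
Definition shuffled_deck (n m : nat) (w : {ffun 'I_n -> 'I_m * bool}) :
    seq 'I_n :=
  let piles := foldr (deal w) (fun=> [::]) (enum 'I_n) in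
  flatten [seq piles j | j <- enum 'I_m].

Local Open Scope ring_scope.

Definition choices_prob (R : realFieldType) (n m : nat) (p : R)
    (w : {ffun 'I_n -> 'I_m * bool}) : R :=
  \prod_(c < n) (m%:R^-1 * (if (w c).2 then p else 1 - p)).

(* s i is the label of the card in position i from the top. *)
Definition shelf_law (R : realFieldType) (n m : nat) (p : R) (s : 'S_n) : R :=
  \sum_(w : {ffun 'I_n -> 'I_m * bool}
         | shuffled_deck w == [seq s i | i <- enum 'I_n])
    choices_prob p w.

Definition Pr (R : realFieldType) (n : nat) (mu : 'S_n -> R) (E : pred 'S_n) :
    R :=
  \sum_(s | E s) mu s.

(** * Signed semistandard tableaux *)

(* (j, true) is the letter j^+ and (j, false) is j^-, so that within a given  *)
(* j the order is true < false.                                               *)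
Definition letter (m : nat) : Type := ('I_m * bool)%type.

Definition letter_le (m : nat) (a b : letter m) : bool :=
  (a.1 < b.1)%N || (a.1 == b.1) && (b.2 ==> a.2).

Definition wt (R : realFieldType) (m : nat) (p : R) (a : letter m) : R :=
  (if a.2 then p else 1 - p) / m%:R.

Definition is_signed_ssyt (m : nat) (la : seq nat)
    (T : {ffun box la -> letter m}) : bool :=
  [&& [forall b, forall c,
         (row_of b == row_of c) && (col_of b < col_of c)%N
           ==> letter_le (T b) (T c)],
      [forall b, forall c,
         (col_of b == col_of c) && (row_of b < row_of c)%N
           ==> letter_le (T b) (T c)],
      [forall j : 'I_m, forall b, forall c,
         [&& col_of b == col_of c, T b == (j, true) & T c == (j, true)]
           ==> (b == c)]
    & [forall j : 'I_m, forall b, forall c,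
         [&& row_of b == row_of c, T b == (j, false) & T c == (j, false)]
           ==> (b == c)]].

Definition S_signed (R : realFieldType) (m : nat) (p : R) (la : seq nat) : R :=
  \sum_(T : {ffun box la -> letter m} | is_signed_ssyt T)
    \prod_(b : box la) wt p (T b).

(* Main.v *)
Require Import Defs.
From mathcomp Require Import all_boot all_order all_algebra all_fingroup.
From mathcomp Require Import zify.

Set Implicit Arguments.
Unset Strict Implicit.
Unset Printing Implicit Defensive.

Import GRing.Theory.

(** Why the theorem holds.  Read the choices made for the cards 1, ..., n as a
word in the signed letters.  Cards with equal letters j+ end up in increasing
order on shelf j, above those with letter j-, which end up in decreasing
order.  So the inverse of the resulting permutation, which sends a card to its
position, is the standardization of the word: it compares two cards as their
letters do, and breaks ties by label, upwards for j+ and downwards for j-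
([deck_perm_inv]).

Row insertion only ever asks whether one entry bumps another.  On signed
letters, let x bump y when x < y, or when x = y is a minus letter.  Insertion
of a word over this relation has the same recording tableau as ordinary
insertion of its standardization ([insertion_deck]), and it is a bijection
from words of length n to pairs of an insertion tableau and a recording
tableau of equal shape ([insertion_inj], [insertion_onto]).  The tableaux that
occur, with rows in which no entry bumps an earlier one and columns in which
every entry bumps those below it, are exactly the signed semistandard ones
([signed_ssytP]).  Fixing the recording tableau Q thus leaves one word for each
signed tableau of the same shape, with the same letters and hence the same
weight; summing gives the first claim ([sum_growth_class]).

The bijection is proved for an arbitrary relation b such that b and the
relation of not being bumped are both transitive; the usual relation < on
numbers is another instance.  A recording tableau is handled through its growth word, which lists
for each time the row that gained a box; growth words are the lattice words
([growth_of_standard], [standard_of_growth]).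

The second claim concerns the shape of the permutation and not of its inverse.
The two shapes agree ([rsk_shape_inv]) by the symmetry of the correspondence.
Follow the first row alone while a set of points (time, value) is inserted: it
turns some times into append times and emits a new set of points
(time, bumped value).  Exchanging the coordinates of the points exchanges
append times with final row entries and reflects the emitted set
([first_row_symmetry]); the emitted points drive the second row, so induction
applies.  Summing the first claim over all standard Q of shape la then yields
the factor num_standard. *)

(** * Row insertion over a bumping relation *)

Section Insertion.

Variables (T : eqType) (b : rel T).

(** [b x y] reads: x bumps y.  With [b := ltn] these are the insertions of a
permutation word; keeping b abstract lets the same theory serve signed
letters. *)
Fixpoint bump_row (x : T) (r : seq T) : seq T * option T :=
  if r is y :: r' then
    if b x y then (x :: r', Some y)
    else let: (r'', bumped) := bump_row x r' in (y :: r'', bumped)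
  else ([:: x], None).

Fixpoint bump_tab (x : T) (t : seq (seq T)) : seq (seq T) * nat :=
  if t is r :: t' then
    match bump_row x r with
    | (r', None) => (r' :: t', 0)
    | (r', Some y) => let: (t'', i) := bump_tab y t' in (r' :: t'', i.+1)
    end
  else ([:: [:: x]], 0).

Definition insertion_step (Pg : seq (seq T) * seq nat) (x : T) :=
  let: (P, i) := bump_tab x Pg.1 in (P, rcons Pg.2 i).

Definition insertion (w : seq T) : seq (seq T) * seq nat :=
  foldl insertion_step ([::], [::]) w.

Definition ptab w := (insertion w).1.
(** The row that gains a box at each step; this word carries the same
information as the recording tableau. *)
Definition growth w := (insertion w).2.

Lemma ptab_rcons w x : ptab (rcons w x) = (bump_tab x (ptab w)).1.
Proof.
rewrite /ptab /insertion foldl_rcons /insertion_step.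
by case: (bump_tab _ _).
Qed.

Lemma growth_rcons w x :
  growth (rcons w x) = rcons (growth w) (bump_tab x (ptab w)).2.
Proof.
rewrite /growth /ptab /insertion foldl_rcons /insertion_step.
by case: (bump_tab _ _).
Qed.

Lemma size_growth w : size (growth w) = size w.
Proof. by elim/last_ind: w => // w x IH; rewrite growth_rcons !size_rcons IH. Qed.

Lemma growth_take w k : growth (take k w) = take k (growth w).
Proof.
elim/last_ind: w => [//|w x IH].
have [lt|ge] := leqP k (size w); last first.
  by rewrite !take_oversize ?size_growth ?size_rcons.
by rewrite growth_rcons -!cats1 !takel_cat ?size_growth.
Qed.

(** The relation to be satisfied along the rows: for numbers it is <=, for
signed letters it is weak increase without repeated minus letters. *)
Definition nondec : rel T := fun x y => ~~ b y x.

(** The column condition between a row r and the next row s; it includes that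
s is not longer than r. *)
Fixpoint dominates (r s : seq T) {struct s} : bool :=
  if s is y :: s' then
    if r is x :: r' then b x y && dominates r' s' else false
  else true.

Fixpoint is_tableau (t : seq (seq T)) : bool :=
  if t is r :: t' then
    [&& r != [::], pairwise nondec r, dominates r (head [::] t') & is_tableau t']
  else true.

(** Reverse bumping: y, coming from the row below, takes the place of the last
entry that bumps it.  When no entry bumps y the result is junk; the lemmas
below assume [has (b^~ y) r]. *)
Fixpoint unbump_row (y : T) (r : seq T) : seq T * T :=
  if r is x :: r' then
    if has (b^~ y) r' then
      let: (r'', z) := unbump_row y r' in (x :: r'', z)
    else (y :: r', x)
  else ([::], y).

Lemma perm_bump_row x r :
  perm_eq ((bump_row x r).1 ++ oapp (fun y => [:: y]) [::] (bump_row x r).2)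
    (x :: r).
Proof.
elim: r => [//|a r IH] /=; case: ifP => _ /=.
  by rewrite perm_cons cats1 perm_rcons.
case: (bump_row x r) IH => r' o /= IH.
apply/seq.permP => u; have := seq.permP IH u.
by rewrite !count_cat /= !count_cat /=; lia.
Qed.

Lemma perm_bump_tab x t : perm_eq (flatten (bump_tab x t).1) (x :: flatten t).
Proof.
elim: t x => [//|r t IH] x /=.
have := perm_bump_row x r; case: (bump_row x r) => r' [y|] /= E; last first.
  by rewrite -[x :: _]/((x :: r) ++ _) perm_cat2r; rewrite cats0 in E.
have := IH y; case: (bump_tab y t) => t' i /= E'.
rewrite -[x :: _]/((x :: r) ++ _).
rewrite (perm_trans (y := r' ++ (y :: flatten t))) ?perm_cat2l //.
by rewrite -cat1s catA perm_cat2r.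
Qed.

Lemma perm_ptab w : perm_eq (flatten (ptab w)) w.
Proof.
elim/last_ind: w => // w x IH; rewrite ptab_rcons.
by rewrite (perm_trans (perm_bump_tab _ _)) // perm_sym perm_rcons perm_cons perm_sym.
Qed.

Lemma mem_bump_row x r r' o : bump_row x r = (r', o) -> {subset r' <= x :: r}.
Proof.
move=> E z zr; rewrite -(perm_mem (perm_bump_row x r)) E /= mem_cat zr //.
Qed.

Lemma bumped_mem x r r' y : bump_row x r = (r', Some y) -> y \in r.
Proof.
elim: r r' => [//|a r IH] r' /=; case: ifP => _ [].
  by move=> _ <-; rewrite mem_head.
case: (bump_row x r) IH => r1 o IH [_ E]; rewrite inE (IH r1) ?orbT //.
by rewrite E.
Qed.

Lemma bumped_b x r r' y : bump_row x r = (r', Some y) -> b x y.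
Proof.
elim: r r' => [//|a r IH] r' /=; case: ifP => // [xa [_ <-]//|_].
by case: (bump_row x r) IH => r1 o IH [_ E]; apply: (IH r1); rewrite E.
Qed.

Lemma bump_row_None x r r' :
  bump_row x r = (r', None) -> r' = rcons r x /\ all (nondec^~ x) r.
Proof.
elim: r r' => [|a r IH] r' /=; first by case=> <-.
rewrite /nondec; case: ifP => // _.
case: (bump_row x r) IH => r1 o IH [<- E]; have [] := IH r1; first by rewrite E.
by move=> -> ->.
Qed.

Lemma bump_row_append x r :
  all (nondec^~ x) r -> bump_row x r = (rcons r x, None).
Proof.
elim: r => [//|a r IH] /= /andP [xa] /IH ->.
by rewrite (negPf xa).
Qed.

Lemma size_bump_row x r r' o :
  bump_row x r = (r', o) -> size r' = size r + ~~ (isSome o).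
Proof.
case: o => [y|] E; last by have [-> _] := bump_row_None E; rewrite size_rcons addn1.
have := perm_size (perm_bump_row x r).
by rewrite E cats1 size_rcons /= => -[->]; rewrite addn0.
Qed.

Lemma shape_bump_tab x t t' i :
  bump_tab x t = (t', i) -> map size t' = incr_nth (map size t) i.
Proof.
elim: t x t' i => [|r t IH] x t' i /=; first by case=> <- <-.
case E: (bump_row x r) => [r' [y|]]; have := size_bump_row E.
  case E2: (bump_tab y t) => [t1 j] /= sz [<- <-] /=.
  by rewrite sz addn0 (IH _ _ _ E2).
by move=> sz [<- <-] /=; rewrite sz addn1.
Qed.

Hypothesis b_trans : transitive b.
Hypothesis nondec_trans : transitive nondec.

Lemma nondec_b_trans y x z : nondec x y -> b y z -> b x z.
Proof.
move=> xy yz; apply: contraTT (yz) => xz.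
exact: (nondec_trans (y := x)).
Qed.

Lemma b_nondec_trans y x z : b x y -> nondec y z -> b x z.
Proof.
move=> xy yz; apply: contraTT (xy) => xz.
exact: (nondec_trans (y := z)).
Qed.

Lemma pairwise_bump_row x r r' o :
  pairwise nondec r -> bump_row x r = (r', o) -> pairwise nondec r'.
Proof.
elim: r r' o => [|a r IH] r' o /=; first by move=> _ [<- _].
case/andP=> /allP ar pr; case: ifP => [xa [<- _]|xa].
  rewrite /= pr andbT; apply/allP => z /ar az; apply: contra az => zx.
  exact: b_trans xa.
case E: (bump_row x r) => [r1 o1] [<- _] /=; rewrite (IH _ _ pr E) andbT.
apply/allP => z /(mem_bump_row E); rewrite inE => /predU1P [->|/ar //].
by rewrite /nondec xa.
Qed.

Lemma dominates_bump_above x r r' y s :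
  bump_row x r = (r', Some y) -> dominates r s -> dominates r' s.
Proof.
elim: r r' s => [//|a r IH] r' [|c s] //=.
case: ifP => [xa [<- _]|xa]; first by case/andP=> ac D; rewrite /= (b_trans xa).
case E: (bump_row x r) => [r1 o] [<- oE] /andP [ac D] /=; rewrite ac.
by apply: IH D; rewrite E oE.
Qed.

(** The bumped entry y travels weakly to the left: below its old place stands an
entry that it bumps, so it lands there or before, under entries that bump
it. *)
Lemma dominates_bump x r r' y s s' o :
  pairwise nondec r -> dominates r s ->
  bump_row x r = (r', Some y) -> bump_row y s = (s', o) -> dominates r' s'.
Proof.
elim: r r' s s' o => [//|a r IH] r' s s' o /= /andP [ar pr].
case: ifP => [xa|xa].
  case: s => [|c s] /=; first by move=> _ [<- <-] [<- _]; rewrite /= xa.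
  by case/andP=> ac D [<- <-]; rewrite ac => -[<- _] /=; rewrite xa.
case E: (bump_row x r) => [r1 o1]; move=> D [<- oE]; rewrite {}oE in E.
have ay : b a y by apply: nondec_b_trans (bumped_b E); rewrite /nondec xa.
case: s D => [|c s] /=; first by move=> _ [<- _]; rewrite /= ay.
case/andP=> ac D; case: ifP => [yc [<- _]|yc].
  by rewrite /= ay (dominates_bump_above E).
case E2: (bump_row y s) => [s1 o2] [<- _] /=; rewrite ac.
exact: IH pr D E E2.
Qed.

Lemma dominates_rcons x r s : dominates r s -> dominates (rcons r x) s.
Proof. by elim: r s => [|a r IH] [|c s] //= /andP [-> /IH]. Qed.

Lemma head_bump_tab y t :
  head [::] (bump_tab y t).1 = (bump_row y (head [::] t)).1.
Proof.
case: t => [//|s t] /=; case: (bump_row y s) => s' [z|] //=.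
by case: (bump_tab z t).
Qed.

Lemma bump_row_neq0 x r : (bump_row x r).1 != [::].
Proof. by case: r => [//|a r] /=; case: ifP => // _; case: (bump_row x r). Qed.

Lemma is_tableau_bump x t : is_tableau t -> is_tableau (bump_tab x t).1.
Proof.
elim: t x => [//|r t IH] x /= /and4P [r0 pr D tt].
have := bump_row_neq0 x r.
case E: (bump_row x r) => [r' [y|]] /= r'0; last first.
  rewrite r'0 (pairwise_bump_row pr E) tt andbT /=.
  by have [-> _] := bump_row_None E; apply: dominates_rcons.
have := IH y tt; have := head_bump_tab y t.
case E2: (bump_tab y t) => [t' i] /= hd ->; rewrite r'0 (pairwise_bump_row pr E).
rewrite andbT /= hd; case E3: (bump_row y _) => [s' o].
exact: dominates_bump E E3.
Qed.

Lemma is_tableau_ptab w : is_tableau (ptab w).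
Proof.
by elim/last_ind: w => // w x IH; rewrite ptab_rcons is_tableau_bump.
Qed.

(** Counting in the growth word gives the row lengths; stated with default 0, it
is insensitive to trailing empty rows. *)
Lemma shape_ptab w i : nth 0 (map size (ptab w)) i = count_mem i (growth w).
Proof.
elim/last_ind: w i => [|w x IH] i; first by rewrite nth_nil.
rewrite ptab_rcons growth_rcons -cats1 count_cat /= addn0 -IH.
case E: (bump_tab x (ptab w)) => [t' j] /=; rewrite (shape_bump_tab E).
by rewrite nth_incr_nth addnC.
Qed.

Lemma unbump_bump x r r' y :
  pairwise nondec r -> bump_row x r = (r', Some y) ->
  unbump_row y r' = (r, x) /\ has (b^~ y) r'.
Proof.
elim: r r' => [//|a r IH] r' /= /andP [ar pr]; case: ifP => [xa|xa].
  case=> <- <- /=; rewrite xa /=; case: hasP => // -[z /(allP ar)].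
  by rewrite /nondec => /negPf ->.
case E: (bump_row x r) => [r1 o] [<- oE]; rewrite {}oE in E.
by have [E1 h] := IH _ pr E; rewrite /= h E1 orbT.
Qed.

Lemma mem_unbump y r : {subset (unbump_row y r).1 <= y :: r}.
Proof.
elim: r => [//|a r IH] z /=; case: ifP => _; last first.
  by rewrite !inE => /orP [->|->]; rewrite ?orbT.
case: (unbump_row y r) IH => r' u /= IH; rewrite inE => /predU1P [->|/IH].
  by rewrite !inE eqxx orbT.
by rewrite !inE => /orP [->|->]; rewrite ?orbT.
Qed.

Lemma unbumped_mem y r : has (b^~ y) r -> (unbump_row y r).2 \in r.
Proof.
elim: r => [//|a r IH] /=; case: ifP => [h _|_]; last by rewrite mem_head.
by case: (unbump_row y r) (IH h) => r' u /= ur; rewrite inE ur orbT.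
Qed.

Lemma unbump_rowP y r' r x :
  pairwise nondec r' -> has (b^~ y) r' -> unbump_row y r' = (r, x) ->
  pairwise nondec r /\ bump_row x r = (r', Some y).
Proof.
elim: r' r x => [//|a r' IH] r x /= /andP [ar pr]; case: ifP => [h _|h ya].
  have := mem_unbump (y := y) (r := r'); have := unbumped_mem h.
  case E: (unbump_row y r') => [r1 x1] /= x1r sub [<- <-].
  have [p1 E1] := IH _ _ pr h E; rewrite /= p1 E1 (negPf (allP ar _ x1r)) andbT.
  split=> //; apply/allP => z /sub; rewrite inE => /predU1P [->|/(allP ar) //].
  have [u /(allP ar) au uy] := hasP h.
  by apply: contra au; apply: b_trans.
case=> <- <- /=; move: ya; rewrite orbF => ->; rewrite pr andbT; split=> //.
by apply/allP => z zr; apply: contraFN h => zy; apply/hasP; exists z.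
Qed.

Lemma dominates_unbump_above y r s :
  all (b y) s -> dominates r s -> dominates (unbump_row y r).1 s.
Proof.
elim: r s => [|a r IH] [|c s] //=.
case/andP=> yc ys /andP [ac D]; case: ifP => h /=; last by rewrite yc.
by case: (unbump_row y r) (IH _ ys D) => r1 x1 /=; rewrite ac.
Qed.

Lemma dominates_has y r s : y \in s -> dominates r s -> has (b^~ y) r.
Proof.
elim: r s => [|a r IH] [|c s] //=; rewrite inE.
by case/predU1P => [->|/IH H] /andP [ac D]; rewrite ?ac // (H D) orbT.
Qed.

Lemma inserted_mem y s : y \in (bump_row y s).1.
Proof.
elim: s => [|a s IH] /=; first by rewrite mem_head.
case: ifP => _; first by rewrite mem_head.
by case: (bump_row y s) IH => s' o /= ys; rewrite inE ys orbT.
Qed.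

(** Reverse bumping moves weakly to the right: beyond the place where y was
inserted below, the entries of s are bumped by y, so y may stand above
them. *)
Lemma dominates_unbump y r s :
  pairwise nondec s -> dominates r (bump_row y s).1 ->
  dominates (unbump_row y r).1 s.
Proof.
elim: r s => [|a r IH] s /=; first by have := bump_row_neq0 y s; case: (_).1.
case: s => [|c s] //=.
case/andP=> cs ps; case: ifP => [yc|yc] /=.
  case/andP=> ay D; have all_s : all (b y) s.
    by apply/allP => z /(allP cs); apply: b_nondec_trans.
  case: ifP => h /=; last by rewrite yc.
  have := dominates_unbump_above all_s D.
  by case: (unbump_row y r) => r1 x1 /= ->; rewrite (b_trans ay).
have := inserted_mem y s; have := IH s ps.
case: (bump_row y s) => s1 o /= {}IH ys1 /andP [ac D].
rewrite (dominates_has ys1 D).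
by case: (unbump_row y r) (IH D) => r1 x1 /= ->; rewrite ac.
Qed.

(** The result shows the row that gained the box; its last entry was appended
there, and reverse bumping from that row upwards recovers the rest. *)
Lemma bump_tab_inj x1 t1 x2 t2 :
  is_tableau t1 -> is_tableau t2 ->
  bump_tab x1 t1 = bump_tab x2 t2 -> t1 = t2 /\ x1 = x2.
Proof.
have size1 r x y : r != [::] -> [:: x] <> rcons r y by case: r => [|a [|c r]].
elim: t1 t2 x1 x2 => [|r1 t1 IH] [|r2 t2] x1 x2 /=.
- by move=> _ _ [->].
- move=> _ /and4P [r0 _ _ _]; case E: (bump_row x2 r2) => [r [y|]].
    by case: (bump_tab y t2).
  by have [-> _] := bump_row_None E; case=> /size1 H _; case: H.
- move=> /and4P [r0 _ _ _] _; case E: (bump_row x1 r1) => [r [y|]].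
    by case: (bump_tab y t1).
  by have [-> _] := bump_row_None E; case=> /esym /size1 H _; case: H.
move=> /and4P [_ p1 _ tt1] /and4P [_ p2 _ tt2].
case E1: (bump_row x1 r1) => [s1 [y1|]]; last first.
  have [-> _] := bump_row_None E1.
  case E2: (bump_row x2 r2) => [s2 [y2|]]; first by case: (bump_tab y2 t2).
  by have [-> _] := bump_row_None E2; case=> /rcons_inj [-> ->] ->.
case F1: (bump_tab y1 t1) => [u1 i1].
case E2: (bump_row x2 r2) => [s2 [y2|]] //.
case F2: (bump_tab y2 t2) => [u2 i2] [es eu ei].
have [et ey] : t1 = t2 /\ y1 = y2 by apply: IH; rewrite // F1 F2 eu ei.
have [D1 _] := unbump_bump p1 E1; have [D2 _] := unbump_bump p2 E2.
by move: D1; rewrite es ey D2 et => -[-> ->].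
Qed.

Lemma size_dominates r s : dominates r s -> size s <= size r.
Proof. by elim: r s => [|a r IH] [|c s] //= /andP [_ /IH]. Qed.

Lemma dominates_belast r x s :
  size s <= size r -> dominates (rcons r x) s -> dominates r s.
Proof.
elim: r s => [|a r IH] [|c s] //=; rewrite ltnS => sz /andP [->].
exact: IH.
Qed.

(** Reverse insertion starting from the corner at the end of row i. *)
Lemma bump_tab_onto t' i :
  is_tableau t' ->
  nth 0 (map size t') i.+1 < nth 0 (map size t') i ->
  exists t x, is_tableau t /\ bump_tab x t = (t', i).
Proof.
elim: i t' => [|i IH] [|r' t'] //= /and4P [r'0 pr D tt].
  rewrite nth0 => lt; case/lastP: r' => [//|r x] in r'0 pr D lt *.
  (* A row of length one is removed altogether: the corner condition makes it
     the last row. *)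
  case: r => [|a r] in r'0 pr D lt *.
    exists [::], x; split=> //=; case: t' tt lt D => [//|s t'] /=.
    by case: s.
  exists (rcons (belast a r) (last a r) :: t'), x.
  rewrite -lastI [_ :: _ as X in [:: X & _]]lock /= -lock tt.
  move: pr; rewrite pairwise_rcons => /andP [ax ->]; rewrite andbT.
  rewrite (dominates_belast _ D); last first.
    by move: lt; rewrite size_rcons ltnS; case: (t').
  by split=> //; rewrite bump_row_append.
move=> lt; have [t [y [tt0 E]]] := IH t' tt lt.
have hd : head [::] t' = (bump_row y (head [::] t)).1 by rewrite -head_bump_tab E.
have h : has (b^~ y) r' by apply: dominates_has D; rewrite hd inserted_mem.
case F: (unbump_row y r') => [r x]; have [p1 F1] := unbump_rowP pr h F.
exists (r :: t), x; rewrite /= F1 E; split=> //; rewrite p1 tt0 andbT /=.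
have ps : pairwise nondec (head [::] t) by case: (t) tt0 => //= s t0 /and4P [].
have := @dominates_unbump y r' _ ps; rewrite -hd F => -> //.
by rewrite andbT; case: (r) F1.
Qed.

(** The words along which the growing shapes stay partitions. *)
Definition lattice (g : seq nat) : Prop :=
  forall k i, count_mem i.+1 (take k g) <= count_mem i (take k g).

Lemma lattice_growth w : lattice (growth w).
Proof.
move=> k i; rewrite -growth_take -!shape_ptab.
elim: (ptab _) i (is_tableau_ptab (take k w)) => [|r t IH] i /=; first by rewrite nth_nil.
case/and4P=> _ _ D tt; case: i => [|i] /=; last exact: IH.
by apply: leq_trans (size_dominates D); case: (t).
Qed.

(** The growth word tells where the last box was added, so the insertions can be
undone one at a time. *)
Theorem insertion_inj : injective insertion.
Proof.
have key w1 w2 : ptab w1 = ptab w2 -> growth w1 = growth w2 -> w1 = w2.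
  elim/last_ind: w1 w2 => [|w1 x1 IH] w2; case/lastP: w2 => [|w2 x2] //.
  - by rewrite growth_rcons => _; case: (growth w2).
  - by rewrite growth_rcons => _; case: (growth w1).
  rewrite !ptab_rcons !growth_rcons => eP /rcons_inj [eg ei].
  have [|ew ->] := bump_tab_inj (x1 := x1) (x2 := x2)
    (is_tableau_ptab w1) (is_tableau_ptab w2).
    by case: (bump_tab x1 _) (bump_tab x2 _) eP ei => ? ? [? ?] /= -> ->.
  by rewrite (IH w2).
by move=> w1 w2 E; apply: key; rewrite /ptab /growth E.
Qed.

(** Undo insertions along g, from its last letter backwards.  Row lengths
are compared with letter counts, index by index: trailing zeros then do no
harm when a row disappears. *)
Theorem insertion_onto t g :
  is_tableau t -> lattice g ->
  (forall i, nth 0 (map size t) i = count_mem i g) ->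
  exists w, insertion w = (t, g).
Proof.
elim/last_ind: g t => [|g i IH] t tt lat sh.
  exists [::]; case: t tt sh => [//|r t] /= /andP [r0 _] /(_ 0) /=.
  by case: (r) r0.
have corner : nth 0 (map size t) i.+1 < nth 0 (map size t) i.
  have := lat (size g) i; rewrite -cats1 takel_cat // take_size => le.
  by rewrite !sh -!cats1 !count_cat /= eqxx (ltn_eqF (ltnSn i)) !addn0 addn1 ltnS.
have [t0 [x [tt0 E]]] := bump_tab_onto tt corner.
have [w Ew] : exists w, insertion w = (t0, g).
  apply: IH => // [k j|j].
    have [le|gt] := leqP k (size g).
      by have := lat k j; rewrite -cats1 takel_cat.
    have := lat (size g) j.
    by rewrite -cats1 takel_cat // take_size [take k g]take_oversize // ltnW.
  have := sh j; rewrite (shape_bump_tab E) nth_incr_nth -cats1 count_cat /=.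
  lia.
by exists (rcons w x); rewrite /insertion foldl_rcons -/(insertion w) Ew
  /insertion_step E.
Qed.

End Insertion.

(** * Insertion of the same word over two relations *)

Section InsertionMap.

Variables (T U : eqType) (f : T -> U) (b : rel U).

Lemma bump_row_map x r :
  bump_row b (f x) (map f r) =
  (map f (bump_row (relpre f b) x r).1, omap f (bump_row (relpre f b) x r).2).
Proof.
elim: r => [//|a r IH] /=; rewrite IH; case: ifP => // _.
by case: (bump_row (relpre f b) x r).
Qed.

Lemma bump_tab_map x t :
  bump_tab b (f x) (map (map f) t) =
  (map (map f) (bump_tab (relpre f b) x t).1, (bump_tab (relpre f b) x t).2).
Proof.
elim: t x => [//|r t IH] x /=; rewrite bump_row_map.
case: (bump_row (relpre f b) x r) => r' [y|] //=; rewrite IH.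
by case: (bump_tab (relpre f b) y t).
Qed.

Lemma insertion_map w :
  insertion b (map f w) =
  (map (map f) (ptab (relpre f b) w), growth (relpre f b) w).
Proof.
elim/last_ind: w => [//|w x IH]; rewrite map_rcons /insertion foldl_rcons.
rewrite -/(insertion b _) IH /insertion_step /= bump_tab_map.
by rewrite ptab_rcons growth_rcons.
Qed.

End InsertionMap.

Section Agreement.

Variables (T : eqType) (b1 b2 : rel T).
Hypotheses (b1_trans : transitive b1) (nondec1_trans : transitive (nondec b1)).
Hypotheses (b2_trans : transitive b2) (nondec2_trans : transitive (nondec b2)).

(** To be read for x standing before y: insertion compares the later entry with
the earlier one, so only [b y x] matters. *)
Definition agree : rel T := fun x y => b1 y x == b2 y x.

(** After bumping, the reading order is the bumped entry y, then the new row.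
The pairs whose order changed are y with the entries on its left and x with
those on its right.  There both relations give the same answer because both
make the old row nondecreasing. *)
Lemma agree_bump_row x r :
  pairwise agree (rcons r x) ->
  pairwise (nondec b1) r -> pairwise (nondec b2) r ->
  bump_row b1 x r = bump_row b2 x r /\
  pairwise agree (oapp (fun y => [:: y]) [::] (bump_row b2 x r).2 ++
                  (bump_row b2 x r).1).
Proof.
elim: r => [//|a r IH] /=; rewrite all_rcons -andbA.
case/and3P=> /eqP ax /allP ag pg /andP[/allP a1 p1] /andP[/allP a2 p2].
rewrite ax; case: ifP => [xa|xa] /=.
  split=> //; move: pg; rewrite pairwise_rcons => /andP [_ ->].
  rewrite /agree ax eqxx andbT /=; apply/andP; split; first exact/allP.
  apply/allP => z zr; have := a1 z zr; have := a2 z zr; rewrite /nondec => n2 n1.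
  have -> : b1 z x = false by apply: contraNF n1 => /b1_trans; apply; rewrite ax.
  by have -> : b2 z x = false by apply: contraNF n2 => /b2_trans; apply.
have [E1 pg'] := IH pg p1 p2; rewrite E1.
case E: (bump_row b2 x r) pg' => [r' [y|]] /=.
  case/andP=> ayr' ->; split=> //; rewrite ayr' !andbT.
  rewrite E in E1; have -> : agree y a.
    have b2ay : b2 a y.
      by apply: (nondec_b_trans nondec2_trans) (bumped_b E); rewrite /nondec xa.
    have b1ay : b1 a y.
      by apply: (nondec_b_trans nondec1_trans) (bumped_b E1); rewrite /nondec ax xa.
    by rewrite /agree b1ay b2ay.
  apply/allP => z /(mem_bump_row E); rewrite inE => /predU1P [->|/ag //].
  by rewrite /agree ax.
move=> ->; split=> //; rewrite andbT.
apply/allP => z /(mem_bump_row E); rewrite inE => /predU1P [->|/ag //].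
by rewrite /agree ax.
Qed.

Lemma agree_bump_tab x t :
  pairwise agree (rcons (flatten (rev t)) x) ->
  is_tableau b1 t -> is_tableau b2 t ->
  bump_tab b1 x t = bump_tab b2 x t /\
  pairwise agree (flatten (rev (bump_tab b2 x t).1)).
Proof.
elim: t x => [//|r t IH] x; rewrite rev_cons flatten_rcons rcons_cat pairwise_cat.
case/and3P=> /allrelP F1 F2 F3 /and4P[_ p1 _ tt1] /and4P[_ p2 _ tt2] /=.
have [-> pg] := agree_bump_row F3 p1 p2.
case E: (bump_row b2 x r) pg => [r' [y|]] /= pg; last first.
  split=> //; rewrite rev_cons flatten_rcons pairwise_cat F2 pg !andbT.
  apply/allrelP => u v Fu /(mem_bump_row E); rewrite -(mem_rcons r x) => vr.
  exact: F1.
have yr := bumped_mem E.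
have [|-> pt] := IH y _ tt1 tt2.
  rewrite pairwise_rcons F2 andbT; apply/allP => u ut; apply: F1 => //.
  by rewrite mem_rcons inE yr orbT.
case E2: (bump_tab b2 y t) pt => [t' i] /= pt; split=> //.
case/andP: pg => /allP ayr' pr'.
rewrite rev_cons flatten_rcons pairwise_cat pt pr' !andbT.
apply/allrelP => u v; have := perm_bump_tab b2 y t; rewrite E2 /= => pe.
have -> : (u \in flatten (rev t')) = (u \in y :: flatten t).
  by rewrite -(perm_mem pe); apply/perm_mem/perm_flatten; rewrite perm_rev.
rewrite inE => /predU1P [->|ut] vr'; first exact: ayr'.
apply: F1; last by rewrite mem_rcons (mem_bump_row E).
rewrite -(perm_mem (s1 := flatten t)) //.
by apply/perm_flatten; rewrite perm_sym perm_rev.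
Qed.

(** The rows of the tableau, read from the bottom row to the top one and
followed by the rest of the word, stay pairwise in agreement, and insertion
makes no other comparison than later against earlier in this order. *)
Theorem insertion_agree w :
  pairwise agree w -> insertion b1 w = insertion b2 w.
Proof.
move=> pw; suff [] : insertion b1 w = insertion b2 w /\
  pairwise agree (flatten (rev (ptab b2 w))) by [].
elim/last_ind: w pw => [//|w x IH]; rewrite pairwise_rcons.
case/andP=> /allP wx /IH [E pg]; rewrite /insertion !foldl_rcons.
rewrite -!/(insertion _ _) E ptab_rcons /insertion_step.
have E1 : (insertion b2 w).1 = ptab b1 w by rewrite /ptab E.
have [|||-> ?] := @agree_bump_tab x (ptab b2 w); last by split.
- rewrite pairwise_rcons pg andbT; apply/allP => u; rewrite /= => uP; apply: wx.
  rewrite -(perm_mem (perm_ptab b2 w)).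
  rewrite -(perm_mem (s1 := flatten (rev (ptab b2 w)))) //.
  by apply/perm_flatten; rewrite perm_rev.
- by rewrite /ptab -E; apply: is_tableau_ptab.
exact: is_tableau_ptab.
Qed.

End Agreement.

(** * Symmetry of the shape under inversion *)

Section Symmetry.

Definition swap (qx : nat * nat) : nat * nat := (qx.2, qx.1).

Lemma swapK : involutive swap. Proof. by case. Qed.

(** The first row seen in isolation.  It is fed with points (time, value);
[append_times] collects the times at which it grows, [bumps] the points
(time, bumped value) that it passes on to the next row. *)
Fixpoint final_row (r : seq nat) (w : seq (nat * nat)) : seq nat :=
  if w is qx :: w' then final_row (bump_row ltn qx.2 r).1 w' else r.

Fixpoint append_times (r : seq nat) (w : seq (nat * nat)) : seq nat :=
  if w is qx :: w' then
    match bump_row ltn qx.2 r with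
    | (r', None) => qx.1 :: append_times r' w'
    | (r', Some _) => append_times r' w'
    end
  else [::].

Fixpoint bumps (r : seq nat) (w : seq (nat * nat)) : seq (nat * nat) :=
  if w is qx :: w' then
    match bump_row ltn qx.2 r with
    | (r', None) => bumps r' w'
    | (r', Some y) => (qx.1, y) :: bumps r' w'
    end
  else [::].

Lemma final_row_cat r w1 w2 :
  final_row r (w1 ++ w2) = final_row (final_row r w1) w2.
Proof. by elim: w1 r => //= qx w1 IH r. Qed.

Lemma append_times_cat r w1 w2 :
  append_times r (w1 ++ w2) =
  append_times r w1 ++ append_times (final_row r w1) w2.
Proof.
elim: w1 r => //= qx w1 IH r.
by case: (bump_row ltn qx.2 r) => r' [y|] /=; rewrite IH.
Qed.

Lemma bumps_cat r w1 w2 :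
  bumps r (w1 ++ w2) = bumps r w1 ++ bumps (final_row r w1) w2.
Proof.
elim: w1 r => //= qx w1 IH r.
by case: (bump_row ltn qx.2 r) => r' [y|] /=; rewrite IH.
Qed.

Lemma append_times_subseq r w : subseq (append_times r w) (map fst w).
Proof.
elim: w r => [//|qx w IH] r /=.
case: (bump_row ltn qx.2 r) => r' [y|]; last by rewrite /= eqxx.
by apply: subseq_trans (IH r') (subseq_cons _ _).
Qed.

Lemma bumps_subseq r w : subseq (map fst (bumps r w)) (map fst w).
Proof.
elim: w r => [//|qx w IH] r /=.
case: (bump_row ltn qx.2 r) => r' [y|] /=; first by rewrite eqxx.
by apply: subseq_trans (IH r') (subseq_cons _ _).
Qed.

Lemma size_final_row r w :
  size (final_row r w) = size r + size (append_times r w).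
Proof.
elim: w r => [|qx w IH] r /=; first by rewrite addn0.
case E: (bump_row ltn qx.2 r) => [r' [y|]] /=; rewrite IH (size_bump_row E) /=; lia.
Qed.

Lemma size_bumps r w : size (bumps r w) + size (append_times r w) = size w.
Proof.
elim: w r => [//|qx w IH] r /=.
case: (bump_row ltn qx.2 r) => r' [y|] /=; have := IH r'; lia.
Qed.

Lemma final_row_mem r w : {subset final_row r w <= r ++ map snd w}.
Proof.
elim: w r => [|qx w IH] r z /=; first by rewrite cats0.
case E: (bump_row ltn qx.2 r) => [r' o] /= /IH; rewrite !mem_cat inE.
case/orP => [/(mem_bump_row E)|->]; last by rewrite !orbT.
by rewrite inE => /orP[->|->]; rewrite ?orbT.
Qed.

Lemma foldl_bump_tab r t w :
  foldl (fun t x => (bump_tab ltn x t).1) (r :: t) (map snd w) =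
  final_row r w :: foldl (fun t x => (bump_tab ltn x t).1) t
                         (map snd (bumps r w)).
Proof.
elim: w r t => [//|qx w IH] r t /=.
case: (bump_row ltn qx.2 r) => r' [y|] /=; last exact: IH.
by case E: (bump_tab ltn y t) => [t' i] /=; rewrite IH.
Qed.

Lemma ptab_foldl w :
  ptab ltn w = foldl (fun t x => (bump_tab ltn x t).1) [::] w.
Proof.
by elim/last_ind: w => // w x IH; rewrite ptab_rcons foldl_rcons IH.
Qed.

Lemma ptab_bumps w : w != [::] ->
  ptab ltn (map snd w) = final_row [::] w :: ptab ltn (map snd (bumps [::] w)).
Proof. by case: w => // qx w _; rewrite !ptab_foldl /= foldl_bump_tab. Qed.

(** The point emitted by the row r when q is inserted at time p, reflected; in
[insert_max] it is the trace left by the value p after its time q. *)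
Definition last_bump (p q : nat) (r : seq nat) : seq (nat * nat) :=
  if (bump_row ltn q r).2 is Some q' then [:: (q', p)] else [::].

Lemma bump_row_rcons_max x p r : x < p ->
  bump_row ltn x (rcons r p) =
  match bump_row ltn x r with
  | (r', Some y) => (rcons r' p, Some y)
  | (r', None) => (r', Some p)
  end.
Proof.
move=> xp; elim: r => [|a r IH] /=; first by rewrite xp.
case: ifP => // _; rewrite IH.
by case: (bump_row ltn x r) => r' [y|].
Qed.

(** An entry p at the end of a row that is larger than all values to come is
bumped exactly when the row without p would have grown for the first time.
From then on the two rows are equal. *)
Lemma run_max p r w : all (ltn^~ p) (map snd w) ->
  append_times (rcons r p) w = behead (append_times r w) /\
  perm_eq (bumps (rcons r p) w)
    (bumps r w ++ if append_times r w is q :: _ then [:: (q, p)] else [::]).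
Proof.
elim: w r => [//|[q x] w IH] r /= /andP [xp wp].
rewrite bump_row_rcons_max //.
case E: (bump_row ltn x r) => [r' [y|]] /=; last first.
  by split=> //; rewrite cats1 perm_sym perm_rcons.
by have [-> pe] := IH r' wp; split=> //; rewrite perm_cons.
Qed.

Lemma bump_row_cat q s1 s2 : all (ltn^~ q) s1 -> all (ltn q) s2 ->
  bump_row ltn q (s1 ++ s2) = (s1 ++ q :: behead s2, ohead s2).
Proof.
elim: s1 => [|a s1 IH] /=; first by case: s2 => [|c s2] //= _ /andP [->].
by case/andP=> aq ? ?; rewrite ltnNge ltnW //= IH.
Qed.

(** Adding a point (q, p) with p larger than all other values acts on the append
times as row insertion of q: the time q is gained, and the next append time
after it is lost because p is bumped then. *)
Lemma insert_max q p u1 u2 :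
  sorted ltn (map fst (u1 ++ (q, p) :: u2)) ->
  all (ltn^~ p) (map snd (u1 ++ u2)) ->
  append_times [::] (u1 ++ (q, p) :: u2) =
    (bump_row ltn q (append_times [::] (u1 ++ u2))).1 /\
  perm_eq (bumps [::] (u1 ++ (q, p) :: u2))
    (bumps [::] (u1 ++ u2) ++ last_bump p q (append_times [::] (u1 ++ u2))).
Proof.
rewrite map_cat sorted_pairwise ?pairwise_cat /=; last exact: ltn_trans.
case/and3P=> /allrelP u1q _ /andP [u2q _]; rewrite map_cat all_cat => /andP [u1p u2p].
have r1p : all (ltn^~ p) (final_row [::] u1).
  by apply/allP => z /final_row_mem /(allP u1p).
have E : bump_row ltn p (final_row [::] u1) = (rcons (final_row [::] u1) p, None).
  apply: bump_row_append; apply/allP => z /(allP r1p) /= zp.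
  by rewrite /nondec /= -leqNgt ltnW.
rewrite !append_times_cat !bumps_cat /= E /last_bump bump_row_cat; first last.
- by apply/allP => z /(mem_subseq (append_times_subseq _ _)) /(allP u2q).
- apply/allP => z /(mem_subseq (append_times_subseq _ _)) zu1.
  by apply: u1q; rewrite ?mem_head.
have [-> pe] := run_max (final_row [::] u1) u2p; split=> //.
by rewrite -catA perm_cat2l; case: (append_times _ u2) pe.
Qed.

(** Induction on the last point (p, q) of v.  On the side of v, the value q is
inserted at the end.  On the side of u, the point (q, p) has the largest value,
and by [insert_max] its presence has the same effect on the append times. *)
Theorem first_row_symmetry u v :
  sorted ltn (map fst u) -> sorted ltn (map fst v) ->
  perm_eq v (map swap u) ->
  final_row [::] v = append_times [::] u /\
  perm_eq (bumps [::] v) (map swap (bumps [::] u)).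
Proof.
elim/last_ind: v u => [|v [p q] IH] u su sv pe.
  by have /perm_size := pe; rewrite size_map; case: u {su pe} => //= _; split.
have qpu : (q, p) \in u.
  rewrite -(mem_map (can_inj swapK)) -(perm_mem pe) mem_rcons; exact: mem_head.
case/splitPr: qpu su pe => u1 u2 su pe.
have pe' : perm_eq v (map swap (u1 ++ u2)).
  move: pe; rewrite map_cat perm_sym perm_catC perm_sym /= -cats1 perm_catC /=.
  by rewrite perm_cons map_cat => /perm_trans -> //; rewrite perm_catC.
have sv' : sorted ltn (map fst v).
  by move: sv; rewrite map_rcons -cats1 => /cat_sorted2 [].
have vp : all (ltn^~ p) (map snd (u1 ++ u2)).
  have -> : map snd (u1 ++ u2) = map fst (map swap (u1 ++ u2)).
    by rewrite -map_comp; apply: eq_map.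
  rewrite -(perm_all _ (perm_map _ pe')).
  move: sv; rewrite map_rcons sorted_pairwise ?pairwise_rcons; last exact: ltn_trans.
  by case/andP.
have su' : sorted ltn (map fst (u1 ++ u2)).
  apply: (subseq_sorted ltn_trans) su; apply: map_subseq.
  by rewrite cat_subseq // subseq_cons.
have [ER EB] := IH _ su' sv' pe'; have [-> pb] := insert_max su vp.
rewrite -cats1 final_row_cat bumps_cat /= ER; split=> //.
apply: perm_trans (_ : perm_eq _ (map swap (_ ++ last_bump p q _))) _; last first.
  by rewrite perm_sym; apply: perm_map pb.
rewrite map_cat /last_bump.
by case: (bump_row ltn q _) => r' [y|] /=; rewrite ?cats0 // perm_cat2r.
Qed.

Theorem shape_symmetry u v :
  sorted ltn (map fst u) -> sorted ltn (map fst v) ->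
  perm_eq v (map swap u) ->
  map size (ptab ltn (map snd u)) = map size (ptab ltn (map snd v)).
Proof.
have [k] := ubnP (size u); elim: k u v => [//|k IH] u v lt su sv pe.
have szv : size v = size u by rewrite (perm_size pe) size_map.
have [u0|u0] := eqVneq u [::]; first by move: szv; rewrite u0; case: (v).
have v0 : v != [::] by rewrite -size_eq0 szv size_eq0.
have [ER EB] := first_row_symmetry su sv pe.
rewrite (ptab_bumps u0) (ptab_bumps v0) /= ER size_final_row /=; congr cons.
apply: IH => //.
- have := size_bumps [::] u; case: (u) u0 lt => [//|[q x] w] _ /=; lia.
- by apply: (subseq_sorted ltn_trans) su; exact: bumps_subseq.
- by apply: (subseq_sorted ltn_trans) sv; exact: bumps_subseq.
Qed.

End Symmetry.

(** * Recording tableaux and standard fillings *)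

Section Recording.

Definition shape_of (g : seq nat) : seq nat := foldl incr_nth [::] g.

Definition times_in_row (g : seq nat) (i : nat) : seq nat :=
  [seq k <- iota 0 (size g) | nth 0 g k == i].

(** A closed form of the tableau that [rsk_word] builds box by box, see
[rsk_wordE]. *)
Definition recording (g : seq nat) : seq (seq nat) :=
  mkseq (times_in_row g) (size (shape_of g)).

Lemma shape_of_rcons g i : shape_of (rcons g i) = incr_nth (shape_of g) i.
Proof. by rewrite /shape_of foldl_rcons. Qed.

Lemma nth_shape_of g i : nth 0 (shape_of g) i = count_mem i g.
Proof.
elim/last_ind: g => [|g a IH]; first by rewrite nth_nil.
by rewrite shape_of_rcons nth_incr_nth IH -cats1 count_cat /= addn0 addnC.
Qed.

Lemma times_in_row_rcons g a i :
  times_in_row (rcons g a) i =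
  times_in_row g i ++ if a == i then [:: size g] else [::].
Proof.
rewrite /times_in_row size_rcons -addn1 iotaD filter_cat /= nth_rcons ltnn eqxx.
congr (_ ++ _); apply: eq_in_filter => k; rewrite mem_iota => /andP [_ lt].
by rewrite nth_rcons lt.
Qed.

Lemma size_times_in_row g i : size (times_in_row g i) = count_mem i g.
Proof.
elim/last_ind: g => [//|g a IH]; rewrite times_in_row_rcons size_cat IH.
by rewrite -cats1 count_cat /= addn0; case: eqP.
Qed.

Lemma times_in_row_lt g i k : k \in times_in_row g i -> k < size g.
Proof. by rewrite mem_filter mem_iota => /andP []. Qed.

Lemma times_in_row_sorted g i : sorted ltn (times_in_row g i).
Proof. by apply: sorted_filter; [apply: ltn_trans|apply: iota_ltn_sorted]. Qed.

Lemma count_times_in_row g i k :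
  count (gtn k) (times_in_row g i) = count_mem i (take k g).
Proof.
elim/last_ind: g => [//|g a IH]; rewrite times_in_row_rcons count_cat IH.
have [le|gt] := leqP k (size g).
  rewrite -cats1 takel_cat // -[RHS]addn0; congr addn.
  by case: eqP => //= _; rewrite ltnNge le.
rewrite [take k (rcons _ _)]take_oversize ?size_rcons // -cats1 count_cat.
rewrite take_oversize 1?ltnW //=; congr addn.
by case: eqP; rewrite //= gt.
Qed.

Lemma nth_recording g i : nth [::] (recording g) i = times_in_row g i.
Proof.
have [lt|ge] := ltnP i (size (shape_of g)); first by rewrite nth_mkseq.
rewrite nth_default ?size_mkseq //; apply/esym/nilP.
by rewrite /nilp size_times_in_row -nth_shape_of nth_default.
Qed.

Lemma shape_recording g : map size (recording g) = shape_of g.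
Proof.
rewrite -map_comp; apply: (@eq_from_nth _ 0) => [|i]; rewrite size_map size_iota //.
by move=> lt; rewrite nth_mkseq //= size_times_in_row nth_shape_of.
Qed.

Lemma recording_rcons g i :
  recording (rcons g i) =
  set_nth [::] (recording g) i (rcons (nth [::] (recording g) i) (size g)).
Proof.
apply: (@eq_from_nth _ [::]) => [|j _].
  rewrite size_set_nth !size_mkseq shape_of_rcons size_incr_nth; case: ltnP; lia.
rewrite nth_set_nth /= !nth_recording times_in_row_rcons eq_sym.
by case: eqP => [->|_]; rewrite ?cats1 ?cats0.
Qed.

Lemma row_insertE x r : row_insert x r = bump_row ltn x r.
Proof. by elim: r => //= y r ->. Qed.

Lemma tab_insertE x t : tab_insert x t = bump_tab ltn x t.
Proof.
elim: t x => [//|r t IH] x /=; rewrite row_insertE.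
by case: (bump_row ltn x r) => r' [y|]; rewrite ?IH.
Qed.

Lemma rsk_wordE w : rsk_word w = (ptab ltn w, recording (growth ltn w)).
Proof.
elim/last_ind: w => [//|w x IH].
rewrite /rsk_word size_rcons -addn1 iotaD /= add0n cats1 zip_rcons ?size_iota //.
rewrite foldl_rcons -/(rsk_word w) IH /rsk_step /= tab_insertE.
rewrite ptab_rcons growth_rcons recording_rcons size_growth.
by case: (bump_tab _ _ _).
Qed.

Lemma shape_growth (T : eqType) (b : rel T) w :
  map size (ptab b w) = shape_of (growth b w).
Proof.
elim/last_ind: w => [//|w x IH]; rewrite ptab_rcons growth_rcons shape_of_rcons.
by case E: (bump_tab b x _) => [t i]; rewrite (shape_bump_tab E) IH.
Qed.

(** With [count_dominates]: two disjoint increasing rows fit on top of each other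
exactly when, for every k, the upper one has at least as many entries below
k. *)
Lemma dominates_count r s k :
  dominates ltn r s -> count (gtn k) s <= count (gtn k) r.
Proof.
elim: s r => [//|c s IH] [|a r] //= /andP [ac /IH].
case: (ltnP c k) => //= ck; first by rewrite (ltn_trans ac ck) !add1n ltnS.
by rewrite add0n => /leq_trans; apply; apply: leq_addl.
Qed.

Lemma count_dominates r s :
  sorted ltn r -> sorted ltn s -> {in s, forall x, x \notin r} ->
  (forall k, count (gtn k) s <= count (gtn k) r) -> dominates ltn r s.
Proof.
rewrite !sorted_pairwise; try exact: ltn_trans.
elim: s r => [//|c s IH] r pr /= /andP [/allP cs ps] dis cnt.
case: r => [|a r] /= in pr dis cnt *; first by have := cnt c.+1; rewrite ltnSn.
case/andP: pr => /allP ar pr.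
have ac : a < c.
  rewrite ltn_neqAle; apply/andP; split.
    by have := dis c (mem_head _ _); rewrite inE negb_or eq_sym => /andP [].
  rewrite leqNgt; apply/negP => ca; have := cnt c.+1; rewrite ltnSn /= [a < _]ltnNge ca /=.
  rewrite add0n (_ : count _ r = 0) //; apply/eqP; rewrite -leqn0 leqNgt -has_count.
  by apply/hasPn => z /ar /= az; rewrite -leqNgt; lia.
rewrite ac; apply: IH => // [x xs|k].
  by have := dis x; rewrite !inE xs orbT negb_or => /(_ isT) /andP [].
have := cnt k; case: (ltnP c k) => ck /=; first by rewrite (ltn_trans ac ck).
move=> _; rewrite (_ : count _ s = 0) //; apply/eqP; rewrite -leqn0 leqNgt -has_count.
by apply/hasPn => z /cs /= cz; rewrite -leqNgt; lia.
Qed.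

Lemma times_in_row_disjoint g i j :
  i != j -> {in times_in_row g j, forall x, x \notin times_in_row g i}.
Proof.
move=> ij x; rewrite !mem_filter => /andP [/eqP -> _].
by rewrite eq_sym (negPf ij).
Qed.

(** This is why growth words of tableaux are lattice words: entries below k in a
row of the recording tableau count letters in a prefix of g. *)
Lemma lattice_dominates g :
  lattice g <-> forall i, dominates ltn (times_in_row g i) (times_in_row g i.+1).
Proof.
split=> [lat i|D k i]; last by rewrite -!count_times_in_row dominates_count.
apply: count_dominates; try exact: times_in_row_sorted.
  by apply: times_in_row_disjoint; rewrite ltn_eqF.
by move=> k; rewrite !count_times_in_row.
Qed.

End Recording.

(** The points (i, s i) of a permutation and those of its inverse are reflections
of each other. *)
Lemma rsk_shape_inv n (s : 'S_n) : rsk_shape (s^-1)%g = rsk_shape s.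
Proof.
pose graph (s : 'S_n) := [seq (val i, val (s i)) | i <- enum 'I_n].
have fstE t : map fst (graph t) = iota 0 n by rewrite -map_comp val_enum_ord.
have sndE t : map snd (graph t) = [seq val (t i) | i <- enum 'I_n].
  by rewrite -map_comp.
rewrite /rsk_shape /P_tab /rsk !rsk_wordE /= -!sndE; apply/esym.
apply: shape_symmetry; rewrite ?fstE ?iota_ltn_sorted //.
have : perm_eq (enum 'I_n) (map s (enum 'I_n)).
  apply: uniq_perm; rewrite ?(map_inj_uniq (@perm_inj _ s)) ?enum_uniq // => i.
  by rewrite mem_enum; apply/esym/mapP; exists (s^-1 i)%g; rewrite ?mem_enum ?permKV.
move=> /(perm_map (fun j => (val j, val ((s^-1)%g j)))) /perm_trans; apply.
rewrite -!map_comp (eq_map (g := swap \o (fun i => (val i, val (s i))))) //.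
by move=> i /=; rewrite permK.
Qed.

Section Fillings.

Variables (la : seq nat).

Definition mk_box (i : 'I_(size la)) (j : 'I_(nth 0 la i)) : box la :=
  Tagged (fun i : 'I_(size la) => 'I_(nth 0 la i)) j.

Definition rows_of (X : Type) (T : box la -> X) : seq (seq X) :=
  [seq [seq T (mk_box j) | j : 'I_(nth 0 la i) <- enum 'I_(nth 0 la i)]
  | i : 'I_(size la) <- enum 'I_(size la)].

Lemma row_lt (u : box la) : row_of u < size la.
Proof. exact: ltn_ord. Qed.

Lemma col_lt (u : box la) : col_of u < nth 0 la (row_of u).
Proof. exact: ltn_ord. Qed.

Lemma box_exists i j : i < size la -> j < nth 0 la i ->
  exists u : box la, row_of u = i /\ col_of u = j.
Proof.
by move=> li lj; exists (@mk_box (Ordinal li) (Ordinal lj)).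
Qed.

Lemma box_eq (u v : box la) :
  row_of u = row_of v -> col_of u = col_of v -> u = v.
Proof.
case: u v => [i j] [i' j']; rewrite /row_of /col_of /= => /val_inj E.
by case: i' / E j' => j' /val_inj ->.
Qed.

Variable X : Type.
Implicit Types T : box la -> X.

Lemma shape_rows_of T : map size (rows_of T) = la.
Proof.
rewrite -map_comp; apply: (@eq_from_nth _ 0); rewrite size_map size_enum_ord //.
move=> i lt; rewrite (nth_map (Ordinal lt)) ?size_enum_ord //=.
by rewrite size_map size_enum_ord nth_enum_ord.
Qed.

Lemma size_rows_of T : size (rows_of T) = size la.
Proof. by rewrite -[RHS](congr1 size (shape_rows_of T)) size_map. Qed.

Lemma size_nth_rows_of T i : size (nth [::] (rows_of T) i) = nth 0 la i.
Proof.
have [lt|ge] := ltnP i (size la).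
  by rewrite -[in RHS](shape_rows_of T) (nth_map [::]) ?size_rows_of.
by rewrite !nth_default ?size_rows_of.
Qed.

Lemma nth_rows_of x0 T (u : box la) :
  nth x0 (nth [::] (rows_of T) (row_of u)) (col_of u) = T u.
Proof.
case: u => [i j]; rewrite /row_of /col_of /=.
rewrite (nth_map i) ?size_enum_ord // nth_ord_enum.
by rewrite (nth_map j) ?size_enum_ord // nth_ord_enum.
Qed.

Lemma rows_of_eq x0 T t :
  map size t = la ->
  (forall u, nth x0 (nth [::] t (row_of u)) (col_of u) = T u) -> rows_of T = t.
Proof.
move=> sh tT; have szt : size t = size la by rewrite -sh size_map.
apply: (@eq_from_nth _ [::]) => [|i]; rewrite size_rows_of ?szt // => li.
have szti : size (nth [::] t i) = nth 0 la i by rewrite -sh (nth_map [::]) ?szt.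
apply: (@eq_from_nth _ x0) => [|j]; rewrite size_nth_rows_of ?szti // => lj.
by have [u [<- <-]] := box_exists li lj; rewrite nth_rows_of tT.
Qed.

End Fillings.

Lemma is_tableauP (X : eqType) (b : rel X) t :
  reflect (forall i, i < size t ->
     [/\ nth [::] t i != [::], pairwise (nondec b) (nth [::] t i) &
         dominates b (nth [::] t i) (nth [::] t i.+1)])
    (is_tableau b t).
Proof.
elim: t => [|r t IH] /=; first by apply: (iffP idP).
apply: (iffP and4P) => [[r0 pr D /IH H] [|i] lt|H].
- by rewrite /= nth0.
- exact: (H i lt).
have [r0 pr] := H 0 isT; rewrite /= nth0 => D; split=> //.
by apply/IH => i lt; apply: (H i.+1).
Qed.

Lemma dominatesP (X : eqType) (b : rel X) x0 r s :
  reflect (size s <= size r /\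
           forall j, j < size s -> b (nth x0 r j) (nth x0 s j))
    (dominates b r s).
Proof.
elim: s r => [|c s IH] [|a r] /=; try by constructor; split.
  by constructor=> -[].
apply: (iffP andP) => [[ac /IH [sz H]]|[sz H]]; first by split=> // -[].
by split; [exact: (H 0)|apply/IH; split=> // j; apply: (H j.+1)].
Qed.

Section Tableaux.

Variables (n : nat) (la : seq nat).
Hypothesis hla : is_partition n la.

Lemma part_pos i : i < size la -> 0 < nth 0 la i.
Proof. by case/and3P: hla => _ /all_nthP H _; apply: H. Qed.

Lemma part_decr i : nth 0 la i.+1 <= nth 0 la i.
Proof.
case/and3P: hla => + _ _; have [lt|ge] := ltnP i.+1 (size la).
  by move/(sortedP 0) => H; apply: H.
by rewrite [nth 0 la i.+1]nth_default.
Qed.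

Lemma box_above (u : box la) i : i <= row_of u ->
  exists v : box la, row_of v = i /\ col_of v = col_of u.
Proof.
move=> le; apply: box_exists; first exact: leq_ltn_trans le (row_lt u).
apply: leq_trans (col_lt u) _; move: le; elim: (row_of u) => [|k IH].
  by rewrite leqn0 => /eqP ->.
rewrite leq_eqVlt => /predU1P [-> //|/IH].
exact: leq_trans (part_decr k).
Qed.

(** The list condition only compares adjacent rows; transitivity of b, together
with la being a partition, extends it to all pairs in a column. *)
Lemma tableau_fillingP (X : eqType) (b : rel X) (T : box la -> X) :
  transitive b ->
  is_tableau b (rows_of T) <->
  (forall u v, row_of u = row_of v -> col_of u < col_of v ->
     nondec b (T u) (T v)) /\
  (forall u v, col_of u = col_of v -> row_of u < row_of v -> b (T u) (T v)).
Proof.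
move=> b_trans; split=> [/is_tableauP H|[Hrow Hcol]].
  split=> [u v erow lt|u v ecol].
    have [|_ /(pairwiseP (T u)) P _] := H (row_of u).
      by rewrite size_rows_of row_lt.
    rewrite -{1}(nth_rows_of (T u) T u) -{1}(nth_rows_of (T u) T v) -erow.
    by apply: P; rewrite ?inE ?size_nth_rows_of ?erow ?col_lt // -erow col_lt.
  have [k] := ubnP (row_of v); elim: k v ecol => [//|k IH] v ecol ltk lt.
  case Ev: (row_of v) lt => [//|i]; rewrite ltnS => le.
  have [v' [ri ci]] := @box_above v i (ltnW (eq_leq (esym Ev))).
  have bv : b (T v') (T v).
    have [|_ _ /(dominatesP _ (T u)) [_ D]] := H i.
      by rewrite size_rows_of (leq_trans _ (row_lt v)) // Ev.
    have := D (col_of v); rewrite size_nth_rows_of -Ev col_lt => /(_ isT).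
    by rewrite -{1}ci -ri !nth_rows_of.
  move: le; rewrite leq_eqVlt => /predU1P [E|lt].
    by rewrite (_ : u = v') //; apply: box_eq; rewrite ?ri ?ci.
  apply: b_trans bv; apply: IH; rewrite ?ri ?ci //; lia.
apply/is_tableauP => i; rewrite size_rows_of => li.
have [u0 _] := box_exists li (part_pos li).
split.
- by rewrite -size_eq0 size_nth_rows_of -lt0n part_pos.
- apply/(pairwiseP (T u0)) => j j'; rewrite !inE size_nth_rows_of => lj lj' lt.
  have [u [ru cu]] := box_exists li lj; have [v [rv cv]] := box_exists li lj'.
  by rewrite -{1}ru -cu -rv -cv !nth_rows_of; apply: Hrow; rewrite ?ru ?rv ?cu ?cv.
apply/(dominatesP _ (T u0)); rewrite !size_nth_rows_of part_decr; split=> // j lj.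
have li' : i.+1 < size la.
  by rewrite ltnNge; apply: contraTN lj => ?; rewrite nth_default.
have [v [rv cv]] := box_exists li' lj.
have [u [ru cu]] := box_exists li (leq_trans lj (part_decr i)).
have E : col_of u = col_of v by rewrite cu cv.
by rewrite -{1}ru -cu -rv {2}E !nth_rows_of; apply: Hcol; rewrite // ru rv.
Qed.

(** Equal counts determine the shape: a partition has no zero part, and g has no
letter beyond the last row. *)
Lemma shape_of_part g :
  (forall i, count_mem i g = nth 0 la i) -> shape_of g = la.
Proof.
move=> cnt; have nthE i : nth 0 (shape_of g) i = nth 0 la i by rewrite nth_shape_of.
apply: (@eq_from_nth _ 0) => // ; apply/eqP; rewrite eqn_leq; apply/andP; split.
  have : all (gtn (size la)) g.
    apply/allP => i ig /=; rewrite ltnNge; apply: contraTN ig => ge.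
    by rewrite -has_pred1 has_count cnt nth_default.
  elim/last_ind: g {cnt nthE} => [//|g i IH]; rewrite all_rcons => /andP [/= lt /IH].
  by rewrite shape_of_rcons size_incr_nth; case: ifP.
rewrite leqNgt; apply/negP => lt; have := part_pos lt.
by rewrite -nthE nth_default.
Qed.

Lemma same_tabP t (Q : {ffun box la -> 'I_n}) :
  reflect (t = rows_of (fun u => val (Q u))) (same_tab t Q).
Proof.
apply: (iffP andP) => [[/eqP sh /forallP H]|->].
  by apply/esym/(rows_of_eq (x0 := 0) sh) => u; apply/eqP/H.
split; first by rewrite shape_rows_of.
by apply/forallP => u; rewrite nth_rows_of.
Qed.

Lemma same_tab_inj t (Q Q' : {ffun box la -> 'I_n}) :
  same_tab t Q -> same_tab t Q' -> Q = Q'.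
Proof.
move=> /andP [_ /forallP H] /andP [_ /forallP H']; apply/ffunP => u.
by apply: val_inj; rewrite /= -(eqP (H u)) -(eqP (H' u)).
Qed.

Lemma standardP (Q : {ffun box la -> 'I_n}) :
  reflect [/\ forall k : 'I_n, exists u, Q u = k, injective Q,
     forall u v, row_of u = row_of v -> col_of u < col_of v -> Q u < Q v &
     forall u v, col_of u = col_of v -> row_of u < row_of v -> Q u < Q v]
    (is_standard Q).
Proof.
apply: (iffP and3P) => [[/forallP C /forallP HR /forallP HC]|[S I HR HC]].
  split.
  - move=> k; have /cards1P [u E] := C k; exists u.
    by have := set11 u; rewrite -E inE => /eqP.
  - move=> u v E; have /cards1P [u0 E0] := C (Q u).
    have : u \in [set u | Q u == Q v] by rewrite inE E.
    have : v \in [set u | Q u == Q v] by rewrite inE.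
    by rewrite -E E0 !inE => /eqP -> /eqP.
  - move=> u v E lt; have /forallP /(_ v) /implyP := HR u; apply.
    by rewrite E eqxx.
  move=> u v E lt; have /forallP /(_ v) /implyP := HC u; apply.
  by rewrite E eqxx.
split.
- apply/forallP => k; have [u E] := S k; apply/cards1P; exists u.
  by apply/setP => v; rewrite !inE -E (inj_eq I).
- by apply/forallP => u; apply/forallP => v; apply/implyP => /andP [/eqP E]; apply: HR.
- by apply/forallP => u; apply/forallP => v; apply/implyP => /andP [/eqP E]; apply: HC.
Qed.

(** The word g lists for each k the row of the box with entry k.  It is a lattice
word because the columns of Q increase, and it can be read off from any
recording tableau that equals Q. *)
Lemma growth_of_standard (Q : {ffun box la -> 'I_n}) : is_standard Q ->
  exists g, [/\ size g = n, lattice g, forall i, count_mem i g = nth 0 la i &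
    forall g', size g' = n -> same_tab (recording g') Q = (g' == g)].
Proof.
move=> std; have /standardP [surj inj HR HC] := std.
pose row_at k := if [pick u | Q u == k :> nat] is Some u then row_of u else 0.
have row_atE u : row_at (Q u) = row_of u.
  rewrite /row_at; case: pickP => [v /eqP /val_inj /inj -> //|/(_ u)].
  by rewrite eqxx.
pose g := mkseq row_at n; have szg : size g = n by rewrite size_mkseq.
pose t := rows_of (fun u => val (Q u)).
have rowE i : times_in_row g i = nth [::] t i.
  apply: (irr_sorted_eq ltn_trans ltnn); first exact: times_in_row_sorted.
    have [li|ge] := ltnP i (size la); last by rewrite nth_default ?size_rows_of.
    rewrite sorted_pairwise; last exact: ltn_trans.
    apply/(pairwiseP 0) => j j'; rewrite !inE size_nth_rows_of => lj lj' lt.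
    have [u [ru cu]] := box_exists li lj; have [v [rv cv]] := box_exists li lj'.
    by rewrite -{1}ru -cu -rv -cv !nth_rows_of; apply: HR; rewrite ?ru ?rv ?cu ?cv.
  move=> k; rewrite mem_filter mem_iota szg /=; apply/andP/idP => [[/eqP <- kn]|].
    have [u E] := surj (Ordinal kn); rewrite nth_mkseq // -[k]/(val (Ordinal kn)) -E.
    rewrite row_atE -(nth_rows_of 0 (fun u => val (Q u)) u) mem_nth //.
    by rewrite size_nth_rows_of col_lt.
  have [li|ge] := ltnP i (size la); last by rewrite nth_default ?size_rows_of.
  case/(nthP 0) => j; rewrite size_nth_rows_of => lj.
  have [u [ru cu]] := box_exists li lj; rewrite -{1}ru -cu nth_rows_of => <-.
  by rewrite nth_mkseq //= row_atE ru eqxx.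
have cnt i : count_mem i g = nth 0 la i.
  by rewrite -size_times_in_row rowE size_nth_rows_of.
have recE : recording g = t.
  apply: (@eq_from_nth _ [::]); last by move=> i _; rewrite nth_recording rowE.
  by rewrite size_mkseq shape_of_part // size_rows_of.
exists g; split=> //.
  apply/lattice_dominates => i; rewrite !rowE.
  have /is_tableauP H : is_tableau ltn t.
    apply/tableau_fillingP => //; first exact: ltn_trans.
    split=> u v E lt; last exact: HC.
    by rewrite /nondec /= -leqNgt ltnW // HR.
  have [li|ge] := ltnP i (size la); first by have [] := H i; rewrite ?size_rows_of.
  by rewrite [nth _ _ i.+1]nth_default ?size_rows_of // ltnW.
move=> g' szg'; apply/same_tabP/eqP => [E|->]; last exact: recE.
apply: (@eq_from_nth _ 0) => [|k]; rewrite ?szg // szg' => kn.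
have [u Eu] := surj (Ordinal kn); rewrite nth_mkseq //.
have -> : k = val (Q u) by rewrite Eu.
rewrite row_atE.
have : val (Q u) \in times_in_row g' (row_of u).
  rewrite -nth_recording E -(nth_rows_of 0 (fun u => val (Q u)) u).
  by rewrite mem_nth // size_nth_rows_of col_lt.
by rewrite mem_filter => /andP [/eqP].
Qed.

(** Rows of the recording tableau increase as lists of times; the column condition
is [lattice_dominates]. *)
Lemma standard_of_growth g : 0 < n ->
  size g = n -> lattice g -> (forall i, count_mem i g = nth 0 la i) ->
  exists Q : {ffun box la -> 'I_n}, is_standard Q && same_tab (recording g) Q.
Proof.
move=> hn szg lat cnt.
have sh : map size (recording g) = la by rewrite shape_recording shape_of_part.
pose q (u : box la) := nth 0 (times_in_row g (row_of u)) (col_of u).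
have q_in u : q u \in times_in_row g (row_of u).
  by rewrite mem_nth // size_times_in_row cnt col_lt.
have q_lt u : q u < n by rewrite -szg (times_in_row_lt (q_in u)).
have q_row u : nth 0 g (q u) = row_of u.
  by have := q_in u; rewrite mem_filter => /andP [/eqP].
pose Q : {ffun box la -> 'I_n} := [ffun u => Ordinal (q_lt u)].
have QE u : val (Q u) = q u by rewrite ffunE.
have recE : recording g = rows_of q.
  by apply/esym/(rows_of_eq (x0 := 0) sh) => u; rewrite nth_recording.
exists Q; apply/andP; split; last first.
  apply/same_tabP; rewrite recE; apply: (rows_of_eq (x0 := 0)).
    exact: shape_rows_of.
  by move=> u; rewrite nth_rows_of QE.
have [] := (tableau_fillingP q ltn_trans).1.
  apply/is_tableauP => i; rewrite size_rows_of -recE => li.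
  rewrite !nth_recording; split.
  - by rewrite -size_eq0 size_times_in_row cnt -lt0n part_pos.
  - have := times_in_row_sorted g i; rewrite sorted_pairwise; last exact: ltn_trans.
    by apply: sub_pairwise => x y; rewrite /nondec /= -leqNgt => /ltnW.
  by have /lattice_dominates := lat.
move=> _ HC; apply/standardP; split=> [k|u v|u v E lt|u v E lt].
- have kn : k < size g by rewrite szg.
  have : val k \in times_in_row g (nth 0 g k) by rewrite mem_filter eqxx mem_iota.
  case/(nthP 0) => j; rewrite size_times_in_row cnt => lj Ej.
  have li : nth 0 g k < size la.
    by rewrite ltnNge; apply: contraTN lj => ?; rewrite nth_default.
  have [u [ru cu]] := box_exists li lj; exists u; apply: val_inj.
  by rewrite QE /q ru cu.
- move/(congr1 val); rewrite !QE => E; apply: box_eq; first by rewrite -!q_row E.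
  have E' : row_of u = row_of v by rewrite -!q_row E.
  have uq := sorted_uniq ltn_trans ltnn (times_in_row_sorted g (row_of u)).
  apply/eqP; rewrite -(nth_uniq 0 _ _ uq) ?size_times_in_row ?cnt ?col_lt //; last first.
    by rewrite E' col_lt.
  by rewrite {2}E'; apply/eqP.
- rewrite !QE /q -E; apply: (sorted_ltn_nth ltn_trans) => //.
  + exact: times_in_row_sorted.
  + by rewrite inE size_times_in_row cnt col_lt.
  + by rewrite inE size_times_in_row cnt E col_lt.
by rewrite !QE; apply: HC.
Qed.

End Tableaux.

(** * Signed letters and the shuffled deck *)

Section Letters.

Variable m : nat.
Implicit Types a b c : letter m.

(** Strictly smaller, or equal to a minus letter: as j+ < j-, on the same shelf
this holds exactly when b is a minus letter. *)
Definition letter_bump a b : bool := (a.1 < b.1) || (a.1 == b.1) && ~~ b.2.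

Lemma nondec_letterE a b :
  nondec (@letter_bump) a b = (a.1 < b.1) || (a.1 == b.1) && a.2.
Proof.
rewrite /nondec /letter_bump negb_or negb_and negbK -leqNgt eq_sym.
by rewrite -val_eqE /=; case: ltngtP.
Qed.

Lemma letter_bump_trans : transitive letter_bump.
Proof.
move=> [b eb] [a ea] [c ec]; rewrite /letter_bump /= -!val_eqE /=.
by case: ea eb ec => [] [] []; case: (ltngtP a b); case: (ltngtP b c);
  case: (ltngtP a c) => //=; lia.
Qed.

Lemma nondec_letter_trans : transitive (nondec letter_bump).
Proof.
move=> [b eb] [a ea] [c ec]; rewrite !nondec_letterE /= -!val_eqE /=.
by case: ea eb ec => [] [] []; case: (ltngtP a b); case: (ltngtP b c);
  case: (ltngtP a c) => //=; lia.
Qed.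

Lemma nondec_letter_le a b :
  nondec letter_bump a b = letter_le a b && ~~ ((a == b) && ~~ a.2).
Proof.
rewrite nondec_letterE /letter_le; case: a b => [a ea] [b eb].
rewrite xpair_eqE -!val_eqE /=.
by case: ea eb => [] []; case: (ltngtP a b).
Qed.

Lemma letter_bump_le a b :
  letter_bump a b = letter_le a b && ~~ ((a == b) && a.2).
Proof.
rewrite /letter_bump /letter_le; case: a b => [a ea] [b eb].
rewrite xpair_eqE -!val_eqE /=.
by case: ea eb => [] []; case: (ltngtP a b).
Qed.

(** Not being bumped means weak increase with no repeated minus letter, and
bumping means weak increase with no repeated plus letter, so the two tableau
conditions unfold to the four conditions on signed tableaux. *)
Lemma signed_ssytP n la (T : {ffun box la -> letter m}) :
  is_partition n la -> is_signed_ssyt T = is_tableau letter_bump (rows_of T).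
Proof.
move=> hla; apply/idP/idP.
  case/and4P=> /forallP HR /forallP HC /forallP Hp /forallP Hm.
  apply/(tableau_fillingP hla _ letter_bump_trans); split=> u v E lt.
    rewrite nondec_letter_le; apply/andP; split.
      by have /forallP /(_ v) /implyP := HR u; apply; rewrite E eqxx.
    apply/negP => /andP [/eqP ET neg]; have /forallP := Hm (T u).1.
    move=> /(_ u) /forallP /(_ v); rewrite E -ET eqxx /=.
    rewrite -(negPf neg) -surjective_pairing eqxx /= => /eqP uv.
    by rewrite uv ltnn in lt.
  rewrite letter_bump_le; apply/andP; split.
    by have /forallP /(_ v) /implyP := HC u; apply; rewrite E eqxx.
  apply/negP => /andP [/eqP ET pos]; have /forallP := Hp (T u).1.
  move=> /(_ u) /forallP /(_ v); rewrite E -ET eqxx /=.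
  rewrite -[true]pos -surjective_pairing eqxx /= => /eqP uv.
  by rewrite uv ltnn in lt.
move=> /(tableau_fillingP hla _ letter_bump_trans) [HR HC].
apply/and4P; split.
- apply/forallP => u; apply/forallP => v; apply/implyP => /andP [/eqP E lt].
  by have := HR u v E lt; rewrite nondec_letter_le => /andP [].
- apply/forallP => u; apply/forallP => v; apply/implyP => /andP [/eqP E lt].
  by have := HC u v E lt; rewrite letter_bump_le => /andP [].
- apply/forallP => j; apply/forallP => u; apply/forallP => v; apply/implyP.
  case/and3P=> /eqP E /eqP Tu /eqP Tv.
  have [lt|lt|E'] := ltngtP (row_of u) (row_of v).
  + by have := HC u v E lt; rewrite letter_bump_le Tu Tv eqxx andbF.
  + by have := HC v u (esym E) lt; rewrite letter_bump_le Tu Tv eqxx andbF.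
  by apply/eqP/box_eq.
apply/forallP => j; apply/forallP => u; apply/forallP => v; apply/implyP.
case/and3P=> /eqP E /eqP Tu /eqP Tv.
have [lt|lt|E'] := ltngtP (col_of u) (col_of v).
- by have := HR u v E lt; rewrite nondec_letter_le Tu Tv eqxx andbF.
- by have := HR v u (esym E) lt; rewrite nondec_letter_le Tu Tv eqxx andbF.
by apply/eqP/box_eq.
Qed.

End Letters.

Lemma pairwise_rev (X : Type) (r : rel X) s :
  pairwise r (rev s) = pairwise (fun x y => r y x) s.
Proof.
by elim: s => [//|x s IH]; rewrite rev_cons pairwise_rcons all_rev IH.
Qed.

Lemma pairwise_enum_ord k : pairwise (fun i j : 'I_k => i < j) (enum 'I_k).
Proof.
rewrite -(pairwise_map val ltn) val_enum_ord -sorted_pairwise.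
  exact: iota_ltn_sorted.
exact: ltn_trans.
Qed.

Section Deck.

Variables (n m : nat) (w : {ffun 'I_n -> letter m}).

(** The order in which two cards lie in the shuffled deck. *)
Definition above (c d : 'I_n) : bool :=
  ((w c).1 < (w d).1) ||
  ((w c).1 == (w d).1) &&
    (if (w c).2 then (w d).2 ==> (c < d) else ~~ (w d).2 && (d < c)).

Lemma above_irr : irreflexive above.
Proof. by move=> c; rewrite /above !ltnn eqxx /=; case: (w c).2. Qed.

Lemma above_asym c d : above c d -> ~~ above d c.
Proof.
rewrite /above -!val_eqE /=.
case: (w c) (w d) => [a ea] [b eb] /=.
by case: (ltngtP a b) => //= _; case: ea eb => [] []; case: (ltngtP c d).
Qed.

(** For a card d after c in the word, deck order and bumping of letters give the
same answer, ties included.  The other direction fails on ties, which is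
why [insertion_agree] must restrict the comparisons made. *)
Lemma above_bump (c d : 'I_n) : c < d -> above d c = letter_bump (w d) (w c).
Proof.
move=> lt; rewrite /above /letter_bump lt [d < c]ltnNge (ltnW lt) /= implybF.
by case: (w d).2; rewrite ?andbT.
Qed.

(** The last card of cs is dealt first, so on its shelf a plus card ends above all
cards that follow it in cs, and a minus card below them. *)
Lemma pilesE cs j :
  foldr (deal w) (fun=> [::]) cs j =
  [seq c <- cs | w c == (j, true)] ++ rev [seq c <- cs | w c == (j, false)].
Proof.
elim: cs => [//|c cs IH] /=; rewrite /deal -/(deal w) IH.
case: (w c) => a e /=; rewrite !xpair_eqE eq_sym; case: (a == j) => //=.
by case: e; rewrite //= rev_cons rcons_cat.
Qed.

Lemma pairwise_above_deck : pairwise above (shuffled_deck w).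
Proof.
rewrite /shuffled_deck.
elim: (enum 'I_m) (pairwise_enum_ord m) => [//|j js IH] /= /andP [jjs /IH pjs].
rewrite pairwise_cat pjs andbT; apply/andP; split.
  apply/allrelP => c d; rewrite pilesE => cj /flattenP [_ /mapP [j' j'js ->]].
  rewrite pilesE => dj'.
  have shelf k (x : 'I_n) :
      x \in [seq c <- enum 'I_n | w c == (k, true)] ++
            rev [seq c <- enum 'I_n | w c == (k, false)] -> (w x).1 = k.
    by rewrite mem_cat mem_rev !mem_filter => /orP [] /andP [/eqP ->].
  by rewrite /above (shelf _ _ cj) (shelf _ _ dj') (allP jjs).
rewrite pilesE pairwise_cat; apply/and3P; split.
- apply/allrelP => c d; rewrite mem_rev !mem_filter => /andP [/eqP wc _] /andP [/eqP wd _].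
  by rewrite /above wc wd eqxx orbT.
- apply: (sub_in_pairwise (P := [pred c | w c == (j, true)])
    (r := fun i j : 'I_n => i < j)); last exact/pairwise_filter/pairwise_enum_ord.
    by move=> c d; rewrite !inE /above => /eqP -> /eqP -> /= ->; rewrite eqxx orbT.
  exact: filter_all.
rewrite pairwise_rev.
apply: (sub_in_pairwise (P := [pred c | w c == (j, false)])
    (r := fun i j : 'I_n => i < j)); last exact/pairwise_filter/pairwise_enum_ord.
  by move=> c d; rewrite !inE /above => /eqP -> /eqP -> /= ->; rewrite eqxx orbT.
exact: filter_all.
Qed.

Lemma perm_deck : perm_eq (shuffled_deck w) (enum 'I_n).
Proof.
apply: uniq_perm; rewrite ?enum_uniq ?(pairwise_uniq above_irr pairwise_above_deck) // => c.
rewrite mem_enum; apply/flattenP; eexists.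
  by apply: map_f; rewrite mem_enum; exact: (erefl ((w c).1 \in 'I_m)).
rewrite pilesE mem_cat mem_rev mem_filter mem_enum mem_filter mem_enum !andbT.
by case: (w c) => a []; rewrite eqxx ?orbT.
Qed.

Lemma size_deck : size (shuffled_deck w) = n.
Proof. by rewrite (perm_size perm_deck) size_enum_ord. Qed.

Lemma deck_inj : injective (fun i : 'I_n => nth i (shuffled_deck w) i).
Proof.
move=> i j; rewrite (set_nth_default j) ?size_deck // => /eqP.
rewrite nth_uniq ?size_deck // => [/eqP /val_inj //|].
by rewrite (perm_uniq perm_deck) enum_uniq.
Qed.

Definition deck_perm : 'S_n := perm deck_inj.

Lemma deck_permP (s : 'S_n) :
  (shuffled_deck w == [seq s i | i <- enum 'I_n]) = (s == deck_perm).
Proof.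
apply/eqP/eqP => [E|->].
  apply/permP => i; rewrite permE E (nth_map i) ?size_enum_ord //.
  by rewrite nth_ord_enum.
case: (pickP 'I_n) => [x0 _|no]; last first.
  have n0 : n = 0 by rewrite -(card_ord n); apply: eq_card0.
  by rewrite (size0nil (etrans size_deck n0)) [RHS]size0nil // size_map size_enum_ord.
apply: (@eq_from_nth _ x0); rewrite size_deck 1?size_map ?size_enum_ord // => i lt.
rewrite (nth_map (Ordinal lt)) ?size_enum_ord // permE /=.
by rewrite nth_enum_ord //; apply: set_nth_default; rewrite size_deck.
Qed.

(** The inverse permutation is the standardization of w. *)
Lemma deck_perm_inv c d :
  ((deck_perm^-1)%g c < (deck_perm^-1)%g d) = above c d.
Proof.
have E : shuffled_deck w = [seq deck_perm i | i <- enum 'I_n].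
  by apply/eqP; rewrite deck_permP.
have mono (i j : 'I_n) : i < j -> above (deck_perm i) (deck_perm j).
  have nthE (k : 'I_n) :
      nth (deck_perm i) [seq deck_perm i | i <- enum 'I_n] k = deck_perm k.
    by rewrite (nth_map i) ?size_enum_ord // nth_ord_enum.
  move=> lt; have /(pairwiseP (deck_perm i)) := pairwise_above_deck.
  rewrite E => /(_ i j); rewrite !inE size_map size_enum_ord !ltn_ord lt.
  by move=> /(_ isT isT isT); rewrite !nthE.
set i := (_ c); set j := (_ d).
have [-> ->] : c = deck_perm i /\ d = deck_perm j by rewrite /i /j !permKV.
case: (ltngtP i j) => [/mono -> //|/mono /above_asym /negPf -> //|/val_inj ->].
by rewrite above_irr.
Qed.

(** Both words are images of the word of cards, which is inserted once over the
deck order and once over bumping of letters. *)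
Lemma insertion_deck :
  growth ltn [seq val ((deck_perm^-1)%g c) | c <- enum 'I_n] =
  growth (@letter_bump m) [seq w c | c <- enum 'I_n].
Proof.
rewrite /growth !insertion_map /= /growth; congr (_.2); apply: insertion_agree.
- by move=> ? ? ?; apply: ltn_trans.
- by move=> ? ? ?; rewrite /nondec /= -!leqNgt => /leq_trans; apply.
- by move=> ? ? ?; apply: letter_bump_trans.
- by move=> ? ? ?; apply: nondec_letter_trans.
apply: sub_pairwise (pairwise_enum_ord n) => c d lt.
by rewrite /agree /= deck_perm_inv above_bump.
Qed.

End Deck.

(** * Summation over the choices *)

Section Probability.
Local Open Scope ring_scope.

Variables (R : realFieldType) (n m : nat) (p : R).

Lemma Pr_shelf_law (E : pred 'S_n) :
  Pr (shelf_law m p) E =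
  \sum_(w : {ffun 'I_n -> letter m} | E (deck_perm w)) choices_prob p w.
Proof.
rewrite /Pr /shelf_law.
rewrite (exchange_big_dep (fun w : {ffun 'I_n -> letter m} => E (deck_perm w))) /=.
  apply: eq_bigr => w Ew; rewrite (big_pred1 (deck_perm w)) // => s.
  by rewrite deck_permP /=; case: eqP => [->|_]; rewrite ?Ew ?andbF.
by move=> s w Es; rewrite deck_permP => /eqP <-.
Qed.

Definition deck_growth (w : {ffun 'I_n -> letter m}) : seq nat :=
  growth (@letter_bump m) [seq w c | c <- enum 'I_n].

Lemma size_deck_growth w : size (deck_growth w) = n.
Proof. by rewrite size_growth size_map size_enum_ord. Qed.

Lemma Q_tab_deck w : Q_tab (deck_perm w)^-1 = recording (deck_growth w).
Proof. by rewrite /Q_tab /rsk rsk_wordE insertion_deck. Qed.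

Lemma rsk_shape_deck w : rsk_shape (deck_perm w) = shape_of (deck_growth w).
Proof.
by rewrite -rsk_shape_inv /rsk_shape /P_tab /rsk rsk_wordE shape_growth insertion_deck.
Qed.

(** Puts the weight of a tableau in a form that depends only on its list of
entries, which insertion permutes. *)
Lemma prod_boxes la (T : box la -> letter m) :
  \prod_(u : box la) wt p (T u) = \prod_(a <- flatten (rows_of T)) wt p a.
Proof.
rewrite big_flatten /= big_map big_enum /=.
rewrite [RHS](eq_bigr (fun i : 'I_(size la) =>
                         \prod_(j < nth 0%N la i) wt p (T (mk_box j)))).
  rewrite (sig_big_dep _ (fun _ _ => true) (fun i j => wt p (T (mk_box j)))) /=.
  by apply: eq_bigr => -[i j].
by move=> i _; rewrite big_map big_enum.
Qed.

(** Insertion maps the words with growth word g bijectively and with equal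
weight onto the signed tableaux of shape la. *)
Lemma sum_growth_class la g (hm : (0 < m)%N) (hla : is_partition n la) :
  size g = n -> lattice g -> (forall i, count_mem i g = nth 0%N la i) ->
  \sum_(w | deck_growth w == g) choices_prob p w = S_signed m p la.
Proof.
move=> szg lat cnt.
have a0 : letter m := (Ordinal hm, true).
pose word (w : {ffun 'I_n -> letter m}) := [seq w c | c <- enum 'I_n].
have nth_word w (c : 'I_n) : nth a0 (word w) c = w c.
  by rewrite (nth_map c) ?size_enum_ord // nth_ord_enum.
pose P w := ptab (@letter_bump m) (word w).
pose h w : {ffun box la -> letter m} :=
  [ffun u => nth a0 (nth [::] (P w) (row_of u)) (col_of u)].
have rows_h w : deck_growth w = g -> rows_of (h w) = P w.
  move=> Ew; apply: (rows_of_eq (x0 := a0)) => [|u]; last by rewrite ffunE.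
  by rewrite shape_growth -/(deck_growth w) Ew (shape_of_part hla).
pose A := [set w | deck_growth w == g].
have hinj : {in A &, injective h}.
  move=> w w'; rewrite !inE => /eqP Ew /eqP Ew' E.
  have EP : P w = P w' by rewrite -rows_h // -rows_h // E.
  have Ewd : word w = word w'.
    apply: (insertion_inj (@letter_bump_trans m) (@nondec_letter_trans m)).
    apply/eqP; rewrite -pair_eqE; apply/andP; split; apply/eqP; first exact: EP.
    exact: etrans Ew (esym Ew').
  by apply/ffunP => c; rewrite -!nth_word Ewd.
have himg T : (T \in h @: A) = is_signed_ssyt T.
  rewrite (signed_ssytP _ hla); apply/imsetP/idP => [[w]|tabT].
    rewrite inE => /eqP Ew ->; rewrite rows_h //.
    exact/is_tableau_ptab/nondec_letter_trans/letter_bump_trans.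
  have [|wd Ewd] := insertion_onto (@letter_bump_trans m)
    (@nondec_letter_trans m) tabT lat.
    by move=> i; rewrite shape_rows_of cnt.
  have szw : size wd = n.
    by rewrite -(size_growth (@letter_bump m)) /growth Ewd.
  pose w : {ffun 'I_n -> letter m} := [ffun c : 'I_n => nth a0 wd c].
  have Ew : word w = wd.
    apply: (@eq_from_nth _ a0) => [|i]; rewrite size_map size_enum_ord ?szw // => lt.
    by rewrite (nth_word w (Ordinal lt)) ffunE.
  have Eg : deck_growth w = g by rewrite /deck_growth -/(word w) Ew /growth Ewd.
  exists w; first by rewrite inE Eg.
  apply/ffunP => u; rewrite ffunE /P Ew /ptab Ewd /=.
  by rewrite nth_rows_of.
rewrite /S_signed -(eq_bigl _ _ himg) big_imset //=.
apply: eq_big => [w|w /eqP Ew]; first by rewrite inE.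
rewrite prod_boxes rows_h // (perm_big _ (perm_ptab _ _)) /= big_map big_enum /=.
by apply: eq_bigr => c _; rewrite /wt mulrC.
Qed.

End Probability.

Unset Implicit Arguments.

Local Open Scope ring_scope.

Theorem theorem2p16 (R : realFieldType) (n m : nat) (p : R) (la : seq nat)
    (hn : (1 <= n)%N) (hm : (1 <= m)%N) (hp0 : 0 < p) (hp1 : p < 1)
    (hla : is_partition n la) :
  (forall Q : {ffun box la -> 'I_n}, is_standard Q ->
     Pr (shelf_law m p) (fun s : 'S_n => same_tab (Q_tab (s^-1)%g) Q)
     = S_signed m p la)
  /\
  Pr (shelf_law m p) (fun s : 'S_n => rsk_shape s == la)
  = (num_standard n la)%:R * S_signed m p la.
Proof.
have claim1 (Q : {ffun box la -> 'I_n}) : is_standard Q ->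
    \sum_(w : {ffun 'I_n -> letter m} | same_tab (recording (deck_growth w)) Q)
      choices_prob p w = S_signed m p la.
  move=> /(growth_of_standard hla) [g [szg lat cnt gP]].
  rewrite -(sum_growth_class p hm hla szg lat cnt); apply: eq_bigl => w.
  by rewrite gP // size_deck_growth.
split=> [Q stdQ|]; rewrite Pr_shelf_law.
  by rewrite -(claim1 Q stdQ); apply: eq_bigl => w; rewrite Q_tab_deck.
rewrite mulr_natl /num_standard -sumr_const.
(* Every word whose tableau has shape la records exactly one standard Q. *)
transitivity (\sum_(Q in [set Q : {ffun box la -> 'I_n} | is_standard Q])
    \sum_(w : {ffun 'I_n -> letter m} | same_tab (recording (deck_growth w)) Q)
      choices_prob p w); last first.
  by apply: eq_bigr => Q; rewrite inE => /claim1.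
rewrite (exchange_big_dep
  (fun w : {ffun 'I_n -> letter m} => rsk_shape (deck_perm w) == la)) /=; last first.
  move=> Q w _ /andP [/eqP sh _].
  by rewrite rsk_shape_deck -shape_recording sh.
apply: eq_bigr => w /eqP sh; rewrite rsk_shape_deck in sh.
have [||||Q /andP [stdQ tabQ]] := standard_of_growth (n := n) hla (g := deck_growth w).
- by [].
- exact: size_deck_growth.
- exact/lattice_growth/nondec_letter_trans/letter_bump_trans.
- by move=> i; rewrite -nth_shape_of sh.
rewrite (big_pred1 Q) // => Q'; rewrite inE.
apply/andP/eqP => [[_ tabQ']|->]; last by [].
exact: same_tab_inj tabQ' tabQ.
Qed.
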